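(* Let $(A,\mathfrak m)$ be a Noetherian local ring of dimension $d$ whose associated graded ring $G_{\mathfrak m}(A)=\bigoplus_{n\ge 0}\mathfrak m^n/\mathfrak m^{n+1}$ is a domain. Let $x\in\mathfrak m^s\setminus\mathfrak m^{s+1}$. Then $\sharp\operatorname{Ass}^{(1)}_A(A/(x))\le s\,e_0(A)$.
   Context: $\operatorname{Ass}^{(1)}_A(M)$ denotes the set of associated primes of the $A$-module $M$ of height $1$, $\sharp$ denotes cardinality, and $e_0(A)$ is the (Hilbert-Samuel) multiplicity of $A$ with respect to $\mathfrak m$. *)

(* Defs.v *)
From HB Require Import structures.
From mathcomp Require Import all_boot all_order all_algebra.
From mathcomp Require Import boolp classical_sets functions cardinality.

Set Implicit Arguments.
Unset Strict Implicit.
Unset Printing Implicit Defensive.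

Import Order.TTheory GRing.Theory Num.Theory.
Local Open Scope classical_set_scope.
Local Open Scope ring_scope.
Local Open Scope quotient_scope.

(* [idealr_closed] of ring_quotient only describes proper ideals; a possibly
   improper ideal of [A] is a submodule of the regular module [A^o].          *)
Definition is_submodule (A : comNzRingType) (M : lmodType A) (N : set M) :=
  submod_closed [in N].

Definition is_ideal (A : comNzRingType) (I : set A) :=
  @is_submodule A A^o I.

Definition is_prime (A : comNzRingType) (P : set A) :=
  idealr_closed [in P] /\ prime_idealr_closed [in P].

Definition is_maximal (A : comNzRingType) (I : set A) :=
  idealr_closed [in I] /\
  forall J : set A, idealr_closed [in J] -> I `<=` J -> J = I.

Definition is_local (A : comNzRingType) (m : {pred A}) :=
  is_maximal [set` m] /\ forall I : set A, is_maximal I -> I = [set` m].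

Section IdealGen.
Variables (A : comNzRingType) (S : set A).

Definition ideal_gen : {pred A^o} :=
  fun a => `[< exists2 t : seq (A * A),
    (forall z, z \in t -> S z.2) & a = \sum_(z <- t) z.1 * z.2 >].

Lemma ideal_gen_closed : @submod_closed A A^o ideal_gen.
Proof.
split; first by apply/asboolP; exists [::]; rewrite ?big_nil.
move=> a u v /asboolP[tu Su ->] /asboolP[tv Sv ->]; apply/asboolP.
exists ([seq (a * z.1, z.2) | z <- tu] ++ tv).
  by move=> z; rewrite mem_cat => /orP[/mapP[y /Su Sy ->]|/Sv].
rewrite big_cat big_map /=; congr (_ + _).
rewrite scaler_sumr; apply: eq_bigr => z _; exact: mulrA.
Qed.

HB.instance Definition _ :=
  GRing.isSubmodClosed.Build A A^o ideal_gen ideal_gen_closed.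

End IdealGen.

Definition noetherian (A : comNzRingType) :=
  forall I : set A, is_ideal I ->
    exists s : seq A, I = [set` ideal_gen [set` s]].

Definition ideal_pow (A : comNzRingType) (I : {pred A}) (n : nat) : {pred A^o} :=
  ideal_gen [set \prod_(i < n) u i | u in [set u : 'I_n -> A | forall i, u i \in I]].

HB.instance Definition _ (A : comNzRingType) (I : {pred A}) n :=
  GRing.isSubmodClosed.Build A A^o (ideal_pow I n) (ideal_gen_closed _).

Section IdealPow.
Variables (A : comNzRingType) (I : idealr A).

Lemma ideal_powE n : ideal_pow I n =
  ideal_gen [set \prod_(i < n) u i | u in [set u : 'I_n -> A | forall i, u i \in I]].
Proof. by []. Qed.

Lemma ideal_pow0 n : (0 : A) \in ideal_pow I n.
Proof. exact: (@rpred0 A^o (ideal_pow I n)). Qed.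

Lemma ideal_powB n (a b : A) :
  a \in ideal_pow I n -> b \in ideal_pow I n -> a - b \in ideal_pow I n.
Proof. exact: (@rpredB A^o (ideal_pow I n)). Qed.

Lemma ideal_pow_sum n (J : finType) (F : J -> A) :
  (forall j, F j \in ideal_pow I n) -> \sum_j F j \in ideal_pow I n.
Proof. by move=> FI; apply: (@rpred_sum A^o (ideal_pow I n)). Qed.

Lemma ideal_pow_prod n (u : 'I_n -> A) :
  (forall i, u i \in I) -> \prod_(i < n) u i \in ideal_pow I n.
Proof.
move=> uI; apply/asboolP; exists [:: (1, \prod_(i < n) u i)].
  by move=> z; rewrite inE => /eqP -> /=; exists u.
by rewrite big_seq1 mul1r.
Qed.

Lemma ideal_pow_full (a : A) : a \in ideal_pow I 0.
Proof.
have := ideal_pow_prod (u := fun i : 'I_0 => 0).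
rewrite big_ord0 => /(_ (fun i => ltac:(by case: i))) I1.
by have := @rpredZ A A^o (ideal_pow I 0) a _ I1; rewrite /GRing.scale /= mulr1.
Qed.

Lemma ideal_powM i j (a b : A) :
  a \in ideal_pow I i -> b \in ideal_pow I j -> a * b \in ideal_pow I (i + j).
Proof.
move=> /asboolP[s Is ->] /asboolP[t It ->].
rewrite mulr_suml big_seq; apply: (@rpred_sum A^o) => y ys.
rewrite mulr_sumr big_seq; apply: (@rpred_sum A^o) => z zt.
rewrite mulrACA; apply: (@rpredZ A A^o).
have [u uI <-] := Is y ys; have [v vI <-] := It z zt.
pose w (k : 'I_(i + j)) := match fintype.split k with inl i => u i | inr j => v j end.
have -> : \prod_(k < i) u k * \prod_(k < j) v k = \prod_(k < i + j) w k.
  rewrite big_split_ord /=; congr (_ * _); apply: eq_bigr => k _; rewrite /w.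
    by case: splitP => [l /= /val_inj -> //|l /= E]; move: (ltn_ord k); rewrite E ltnNge leq_addr.
  by case: splitP => [l /= E|l /= /addnI /val_inj -> //]; move: (ltn_ord l); rewrite -E ltnNge leq_addr.
by apply: ideal_pow_prod => k; rewrite /w; case: fintype.split.
Qed.

Lemma ideal_powS n (a : A) : a \in ideal_pow I n.+1 -> a \in ideal_pow I n.
Proof.
move=> /asboolP[s Is ->]; rewrite big_seq; apply: (@rpred_sum A^o) => y ys.
apply: (@rpredZ A A^o); have [u uI <-] := Is y ys.
by rewrite big_ord_recl; apply: (@rpredZ A A^o); apply: ideal_pow_prod.
Qed.

Lemma ideal_pow1 (a : A) : (a \in ideal_pow I 1) = (a \in I).
Proof.
apply/idP/idP => [/asboolP[s Is ->]|Ia].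
  rewrite big_seq; apply: rpred_sum => y ys; apply: idealMr.
  by have [u uI <-] := Is y ys; rewrite big_ord1.
by have := ideal_pow_prod (fun _ : 'I_1 => Ia); rewrite big_ord1.
Qed.

End IdealPow.

(* The direct sum of the [I^n / I^(n+1)] is obtained from the sequences
   [(a_n)] with finite support and [a_n \in I^n], written as the polynomial
   [\sum_n a_n 'X^n] (these form the Rees ring), by identifying two of them when
   [a_n - b_n \in I^(n+1)] for all [n]. The product is the convolution product. *)
Section AssociatedGraded.
Variables (A : comNzRingType) (I : idealr A).

Definition rees : {pred {poly A}} :=
  fun p => `[< forall n, p`_n \in ideal_pow I n >].

Lemma rees_closed : subring_closed rees.
Proof.
split=> [|p q /asboolP pI /asboolP qI|p q /asboolP pI /asboolP qI]; apply/asboolP=> n.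
- rewrite coef1; case: n => [|n] /=; first exact: ideal_pow_full.
  exact: ideal_pow0.
- by rewrite coefB ideal_powB.
- rewrite coefM; apply: ideal_pow_sum => j.
  by have := ideal_powM (pI j) (qI (n - j)%N); rewrite subnKC // -ltnS.
Qed.

HB.instance Definition _ := GRing.isSubringClosed.Build {poly A} rees rees_closed.

Record rees_ring := ReesRing { rees_val :> {poly A}; _ : rees_val \in rees }.

HB.instance Definition _ := [isSub for rees_val].
HB.instance Definition _ := [Choice of rees_ring by <:].
HB.instance Definition _ := [SubChoice_isSubComNzRing of rees_ring by <:].

Definition rees_shift : {pred rees_ring} :=
  fun p => `[< forall n, (val p)`_n \in ideal_pow I n.+1 >].

Lemma rees_shift_closed : idealr_closed rees_shift.
Proof.
split=> [||a p q /asboolP pI /asboolP qI].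
- by apply/asboolP => n; rewrite raddf0 coef0 ideal_pow0.
- apply/negP => /asboolP /(_ 0%N).
  by rewrite rmorph1 coef1 ideal_pow1 idealr1.
- apply/asboolP => n; rewrite rmorphD rmorphM coefD.
  apply: (@rpredD A^o) (qI n); rewrite coefM; apply: ideal_pow_sum => j.
  have /asboolP /(_ j) := valP a; move=> aI.
  by have := ideal_powM aI (pI (n - j)%N); rewrite addnS subnKC // -ltnS.
Qed.

HB.instance Definition _ := isIdealr.Build rees_ring rees_shift rees_shift_closed.

Definition assoc_graded : comNzRingType := {ideal_quot rees_shift}.

End AssociatedGraded.

Section QuotientModule.
Variables (A : comNzRingType) (M : lmodType A) (N : submodClosed M).

(* [submodClosed] does not inherit from [zmodClosed], which [Quotient.quot] requires. *)
Definition submod_pred : {pred M} := N.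

HB.instance Definition _ :=
  GRing.isSubmodClosed.Build A M submod_pred (submodClosedP N).

Definition quot_module := Quotient.quot submod_pred.

HB.instance Definition _ := GRing.Zmodule.on quot_module.

Definition quot_scale (a : A) (v : quot_module) : quot_module :=
  \pi_quot_module (a *: repr v).

Lemma pi_quot_scale a (v : M) :
  quot_scale a (\pi_quot_module v) = \pi_quot_module (a *: v).
Proof.
apply/eqP; rewrite -Quotient.idealrBE -scalerBr.
apply: (@rpredZ A M submod_pred).
by move/eqP: (reprK (\pi_quot_module v)); rewrite -Quotient.idealrBE.
Qed.

Lemma quot_moduleW (P : quot_module -> Prop) :
  (forall v, P (\pi_quot_module v)) -> forall v, P v.
Proof. by move=> Ppi v; rewrite -[v]reprK. Qed.

Lemma pi_quotD u v :
  \pi_quot_module (u + v) = \pi_quot_module u + \pi_quot_module v.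
Proof. exact: raddfD. Qed.

Lemma pi_quot_eq0 v : \pi_quot_module v = 0 <-> v \in N.
Proof.
have <- : \pi_quot_module 0 = 0 :> quot_module by exact: raddf0.
split=> [/eqP|vN]; first by rewrite -Quotient.idealrBE subr0.
by apply/eqP; rewrite -Quotient.idealrBE subr0.
Qed.

Lemma quot_scaleA a b v : quot_scale a (quot_scale b v) = quot_scale (a * b) v.
Proof.
elim/quot_moduleW: v => v.
by rewrite (pi_quot_scale b) (pi_quot_scale a) (pi_quot_scale (a * b)) scalerA.
Qed.

Lemma quot_scale1 : left_id 1 quot_scale.
Proof. by elim/quot_moduleW => v; rewrite (pi_quot_scale 1) scale1r. Qed.

Lemma quot_scaleDr : right_distributive quot_scale +%R.
Proof.
move=> a; elim/quot_moduleW => u; elim/quot_moduleW => v.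
by rewrite -pi_quotD 3!(pi_quot_scale a) scalerDr pi_quotD.
Qed.

Lemma quot_scaleDl v : {morph quot_scale^~ v : a b / a + b}.
Proof.
elim/quot_moduleW: v => v a b.
by rewrite (pi_quot_scale a) (pi_quot_scale b) (pi_quot_scale (a + b)) scalerDl pi_quotD.
Qed.

HB.instance Definition _ := GRing.Zmodule_isLmodule.Build A quot_module
  quot_scaleA quot_scale1 quot_scaleDr quot_scaleDl.

End QuotientModule.

Lemma scale_pi_quot (A : comNzRingType) (M : lmodType A) (N : submodClosed M) a v :
  a *: (\pi_(quot_module N) v : quot_module N) = \pi_(quot_module N) (a *: v).
Proof. exact: pi_quot_scale. Qed.

Lemma assoc_graded_pi_eq0 (A : comNzRingType) (I : idealr A) (p : rees_ring I) :
  \pi_(assoc_graded I) p = 0 <-> forall n, (val p)`_n \in ideal_pow I n.+1.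
Proof.
have <- : \pi_(assoc_graded I) 0 = 0 by exact: raddf0.
split=> [/eqP|pI]; first by rewrite -Quotient.idealrBE subr0 => /asboolP.
by apply/eqP; rewrite -Quotient.idealrBE subr0; apply/asboolP.
Qed.

Definition strict_chain (T : Type) (F : set (set T)) (n : nat) (c : nat -> set T) :=
  (forall i, (i <= n)%N -> F (c i)) /\ forall i, (i < n)%N -> c i `<` c i.+1.

Definition max_chain_length (T : Type) (F : set (set T)) (n : nat) :=
  (exists c, strict_chain F n c) /\
  forall k c, strict_chain F k c -> (k <= n)%N.

Definition has_krull_dim (A : comNzRingType) (d : nat) :=
  max_chain_length [set P : set A | is_prime P] d.

Definition has_height (A : comNzRingType) (P : set A) (h : nat) :=
  max_chain_length [set Q : set A | is_prime Q /\ Q `<=` P] h.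

Definition has_length (A : comNzRingType) (M : lmodType A) (l : nat) :=
  max_chain_length [set N : set M | is_submodule N] l.

Definition Ass (A : comNzRingType) (M : lmodType A) : set (set A) :=
  [set P | is_prime P /\ exists v : M, P = [set a | a *: v = 0]].

Definition Ass_height (h : nat) (A : comNzRingType) (M : lmodType A) : set (set A) :=
  [set P | Ass M P /\ has_height P h].

Definition is_hilbert_samuel_poly (A : comNzRingType) (m : {pred A}) (H : {poly rat}) :=
  exists N, forall n, (N <= n)%N ->
    exists2 l, has_length (quot_module (ideal_pow m n.+1)) l & H.[n%:R] = l%:R.

Definition hilbert_samuel_poly (A : comNzRingType) (m : {pred A}) : {poly rat} :=
  xget 0 [set H | is_hilbert_samuel_poly m H].

(* The polynomial is unique when it exists. For [d] the Krull dimension of a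
   Noetherian local ring [A], this is [e_0(A)]: the expansion
   [H(n) = e_0 C(n+d, d) - e_1 C(n+d-1, d-1) + ...] gives [e_0 = d! H_d].     *)
Definition multiplicity (A : comNzRingType) (m : {pred A}) (d : nat) : rat :=
  d`!%:R * (hilbert_samuel_poly m)`_d.

(* Main.v *)
(** Since the associated graded ring G is a domain, the order of vanishing v is additive on A,
    hence m^n : x = m^(n-s) and length(A/(x, m^n)) = H(n) - H(n-s), where H(n) = length(A/m^n)
    is a polynomial with leading coefficient e_0/d!. If P_1, ..., P_r are distinct primes of
    height one containing x, then A/(x) maps onto A/(P_1 /\ ... /\ P_r), and Artin-Rees gives
    H(n) - H(n-s) >= sum_i length(A/(P_i + m^(n-c_i))). A polynomial of degree d-1 with integral
    values has leading coefficient at least 1/(d-1)!, so comparing leading coefficients bounds r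
    by s e_0 as soon as dim A/P_i >= d-1.

    This last inequality fails in a general local domain. Suppose that P has height one and
    dim A/P <= d-2. Choose f1, f2 in P whose leading forms start a homogeneous system of
    parameters f1, ..., fd of G. As P has height one there is a y outside P such that y/x has
    denominators supported in f1 = f2 = 0. Noether normalisation embeds a multiple cG in
    a module W[f1] that is free over f1 and stable under f2, on which f1, f2 is a regular
    sequence. Hence cb is a leading form of A for every leading form b of an element of A[y/x],
    these leading forms make up an ascending chain of ideals of the noetherian ring G, and y/x
    is integral over A. So a power of y lies in (x), and thus y lies in P. *)

(* The obstacle in bounding dim A/P is that G may have depth one: f1, f2 start a system of
   parameters but need not be a regular sequence on G, so a fraction with denominators on f1 = f2 =
   0 need not have a leading form in G. The multiplier c repairs this at a fixed cost: it does not
   depend on the power of y/x, so the leading forms of all the cb stay in the one noetherian ring G.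

   Apart from the translation of the domain hypothesis, G is not handled as a ring. A homogeneous
   ideal is a sequence of ideals Z n of A between m^(n+1) and m^n, and forms of degree n are equal
   when their difference lies in m^(n+1). Dimensions are sizes of Hilbert polynomials, and meet
   chains of primes only in [adim_krull_dim]. Primes of given dimension, Hilbert polynomials and
   prime avoidance come from maximal members of noetherian families, using I : f and I + (f) in
   place of primary decompositions. *)
Require Import Defs.
From HB Require Import structures.
From mathcomp Require Import all_boot all_order all_algebra.
From mathcomp Require Import boolp classical_sets functions cardinality.
From mathcomp Require Import ring zify lra.

Set Implicit Arguments.
Unset Strict Implicit.
Unset Printing Implicit Defensive.

Import Order.TTheory GRing.Theory Num.Theory.
Local Open Scope classical_set_scope.
Local Open Scope ring_scope.

(** * Ideals as sets and composition series *)

(* Improper ideals included. *)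
Definition idl (A : comNzRingType) (I : set A) :=
  I 0 /\ forall a u v, I u -> I v -> I (a * u + v).

Section Ideals.
Variable A : comNzRingType.
Implicit Types (I J : set A) (f : A).

Lemma idl0 I : idl I -> I 0.
Proof. by case. Qed.

Lemma idlM I a u : idl I -> I u -> I (a * u).
Proof. by case=> I0 IP Iu; rewrite -[_ * _]addr0; apply: IP. Qed.

Lemma idlD I u v : idl I -> I u -> I v -> I (u + v).
Proof. by case=> I0 IP Iu Iv; rewrite -[u]mul1r; apply: IP. Qed.

Lemma idlN I u : idl I -> I u -> I (- u).
Proof. by move=> iI /(idlM (-1) iI); rewrite mulN1r. Qed.

Lemma idlB I u v : idl I -> I u -> I v -> I (u - v).
Proof. by move=> iI Iu Iv; apply: idlD => //; apply: idlN. Qed.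

Lemma idlBC I u v : idl I -> I (u - v) -> I (v - u).
Proof. by move=> iI /(idlN iI); rewrite opprB. Qed.

Lemma idl_sub I u v : idl I -> I (u - v) -> I v -> I u.
Proof. by move=> iI Iuv Iv; rewrite -(subrK v u); apply: idlD. Qed.

Lemma idl_sum I (T : Type) (r : seq T) (F : T -> A) :
  idl I -> (forall i, I (F i)) -> I (\sum_(i <- r) F i).
Proof.
move=> iI IF; elim: r => [|i r IH]; first by rewrite big_nil; exact: idl0.
by rewrite big_cons; apply: idlD.
Qed.

Lemma idlI I J : idl I -> idl J -> idl (I `&` J).
Proof.
move=> iI iJ; split; first by split; apply: idl0.
by move=> a u v [Iu Ju] [Iv Jv]; split; apply: idlD => //; apply: idlM.
Qed.

Lemma idlT : idl [set: A].
Proof. by []. Qed.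

Definition addmul f J I : set A := [set z | exists2 a, J a & I (z - f * a)].

Lemma idl_addmul f J I : idl J -> idl I -> idl (addmul f J I).
Proof.
move=> iJ iI; split.
  by exists 0; [exact: idl0 | rewrite mulr0 subr0; exact: idl0].
move=> c u v [a Ja Iu] [b Jb Iv]; exists (c * a + b); first by case: iJ => _; apply.
rewrite (_ : _ - _ = c * (u - f * a) + (v - f * b)); last by ring.
by case: iI => _; apply.
Qed.

Lemma addmulr f J I z : idl J -> I z -> addmul f J I z.
Proof. by move=> iJ Iz; exists 0; [exact: idl0 | rewrite mulr0 subr0]. Qed.

Lemma addmull f J I a : idl I -> J a -> addmul f J I (f * a).
Proof. by move=> iI Ja; exists a => //; rewrite subrr; exact: idl0. Qed.

Definition colon I f : set A := [set a | I (f * a)].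

Lemma idl_colon I f : idl I -> idl (colon I f).
Proof.
move=> iI; split; rewrite /colon /=; first by rewrite mulr0; exact: idl0.
move=> a u v Iu Iv; rewrite (_ : f * _ = a * (f * u) + f * v); last by ring.
by case: iI => _; apply.
Qed.

End Ideals.

Section Length.
Variables (A : comNzRingType) (K : set A).
Hypotheses (iK : idl K) (Kunit : forall a, ~ K a -> exists b, b * a = 1).
Implicit Types (V W X Y : set A).

(* A composition series from [W] to [V]: [V = X + A u] with [K u] inside [X], where [K] is
   the maximal ideal, so each step has length one. *)
Inductive Len : set A -> set A -> nat -> Prop :=
| Len0 W : Len W W 0
| LenS W X V n u : Len W X n -> ~ X u -> (forall a, K a -> X (a * u)) ->
    (forall v, V v <-> exists a, X (v - a * u)) -> Len W V n.+1.

Lemma Len_sub W V n : Len W V n -> W `<=` V.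
Proof.
elim=> [? //|{}W X {}V k u _ WX _ _ VE w /WX Xw]; apply/VE.
by exists 0; rewrite mul0r subr0.
Qed.

Lemma step_idl X V u : idl X ->
  (forall v, V v <-> exists a, X (v - a * u)) -> idl V.
Proof.
move=> iX VE; split; first by apply/VE; exists 0; rewrite mul0r subr0; exact: idl0.
move=> c v w /VE[a Xa] /VE[b Xb]; apply/VE; exists (c * a + b).
rewrite (_ : _ - _ = c * (v - a * u) + (w - b * u)); last by ring.
by case: iX => _; apply.
Qed.

Lemma Len_idl W V n : Len W V n -> idl W -> idl V.
Proof. by elim=> [? //|{}W X {}V k u _ IH _ _ VE /IH iX]; exact: step_idl VE. Qed.

Lemma Len_cat W X V a b : Len W X a -> Len X V b -> Len W V (a + b).
Proof.
move=> WX XV; elim: XV W a WX => [{X V b}X W a|{X V b}X Y V n u _ IH nYu KY VE W a WX].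
  by rewrite addn0.
by rewrite addnS; apply: (LenS (IH _ _ WX) nYu KY VE).
Qed.

(** Multiplication by [f] is an isomorphism from V/W onto (fV + W')/W', as the last hypothesis makes
    W the kernel of V -> A/W'. The exact sequences relating I : f, I and I + (f) below all come from
    it. *)
Lemma Len_map W V n W' f : Len W V n -> idl W -> idl W' ->
  (forall a, V a -> (W' (f * a) <-> W a)) -> Len W' (addmul f V W') n.
Proof.
move=> WV iW iW'; elim: WV iW => {V W n}[W iW WE|W X V n u WX IH nXu KX VE iW WE].
  have -> : addmul f W W' = W'; last exact: Len0.
  apply/seteqP; split=> z; last by move=> W'z; apply: addmulr.
  by move=> [a Wa /(idl_sub iW')]; apply; apply/WE.
have iX : idl X := Len_idl WX iW.
have iV : idl V := step_idl iX VE.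
have XV : X `<=` V by move=> a Xa; apply/VE; exists 0; rewrite mul0r subr0.
have Vu : V u by apply/VE; exists 1; rewrite mul1r subrr; exact: idl0.
apply: (@LenS _ (addmul f X W') _ _ (f * u)).
- by apply: IH => // a /XV; exact: WE.
- move=> [a Xa]; rewrite -mulrBr => /WE.
  have Vua : V (u - a) by apply: idlB => //; exact: XV.
  by move=> /(_ Vua) /(Len_sub WX) /(idl_sub iX) /(_ Xa).
- by move=> a Ka; rewrite mulrCA; apply: addmull => //; exact: KX.
- move=> v; split.
    move=> [a /VE[b Xb] W'v]; exists b; exists (a - b * u) => //.
    by rewrite (_ : _ - _ = v - f * a); last ring.
  move=> [b [a Xa W'v]]; exists (a + b * u).
    by apply: idlD => //; [exact: XV | exact: idlM].
  by rewrite (_ : _ - _ = v - b * (f * u) - f * a); last ring.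
Qed.

(** Second isomorphism theorem for V/(V ∩ Y) and (V + Y)/Y. *)
Lemma Len_iso W V X Y n : Len W V n -> idl V -> idl Y -> W = V `&` Y ->
  X = addmul 1 V Y -> Len Y X n.
Proof.
move=> WV iV iY WE ->; apply: (Len_map WV) => //; first by rewrite WE; exact: idlI.
by move=> a Va; rewrite mul1r WE; split=> // -[].
Qed.

Lemma Len_meet W V n Y : Len W V n -> idl W -> idl Y -> W `<=` Y ->
  exists a b, [/\ Len W (V `&` Y) a, Len (V `&` Y) V b & (n = a + b)%N].
Proof.
move=> WV iW iY; elim: WV iW => {V W n}[W iW WY|W X V n u WX IH nXu KX VE iW WY].
  by exists 0%N, 0%N; rewrite (setIidl WY); split=> //; exact: Len0.
have [a [b [La Lb ->]]] := IH iW WY.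
have iX : idl X := Len_idl WX iW.
have iV : idl V := step_idl iX VE.
have XV : X `<=` V by move=> c Xc; apply/VE; exists 0; rewrite mul0r subr0.
have Vu : V u by apply/VE; exists 1; rewrite mul1r subrr; exact: idl0.
have [VYX|] := pselect (V `&` Y `<=` X).
  have E : V `&` Y = X `&` Y.
    by apply/seteqP; split=> z [Vz Yz]; split=> //; [exact: VYX | exact: XV].
  exists a, b.+1; rewrite E addnS; split=> //.
  exact: LenS Lb nXu KX VE.
move=> /existsNP[y /not_implyP[[Vy Yy] nXy]].
have [c Xc] := (VE y).1 Vy.
(* The coefficient c is thus a unit, and y can replace u as generator of V over X. *)
have nKc : ~ K c.
  by move=> /KX Xcu; apply: nXy; apply: idl_sub Xc Xcu.
have [c' c'c] := Kunit nKc.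
have VEy v : V v -> exists e, X (v - e * y).
  move=> /VE[e Xe]; exists (e * c').
  rewrite (_ : _ - _ = (v - e * u) - e * c' * (y - c * u) + e * u * (1 - c' * c)); last by ring.
  rewrite c'c subrr mulr0 addr0; apply: idlB => //; exact: idlM.
exists a.+1, b; split=> //.
- apply: (LenS La (u := y)).
  + by case.
  + move=> e Ke; split; last exact: idlM.
    rewrite (_ : e * y = e * (y - c * u) + c * (e * u)); last by ring.
    by apply: idlD => //; apply: idlM => //; exact: KX.
  + move=> v; split=> [[Vv Yv]|[e [Xe Ye]]].
      have [e Xe] := VEy _ Vv; exists e; split=> //.
      by apply: idlB => //; exact: idlM.
    split.
      by apply: (idl_sub iV (XV _ Xe)); exact: idlM.
    by apply: (idl_sub iY Ye); exact: idlM.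
- apply: (Len_iso Lb) => //; first exact: idlI.
    by apply/seteqP; split=> z; [move=> [Xz Yz]; do !split => //; exact: XV | move=> [? []]].
  apply/seteqP; split=> z.
    move=> Vz; have [e Xe] := VEy _ Vz.
    exists (z - e * y) => //; rewrite (_ : _ - _ = e * y); last by ring.
    by split; apply: idlM.
  move=> [e Xe]; rewrite mul1r => -[Vz _].
  exact: (idl_sub iV Vz (XV _ Xe)).
Qed.

Lemma Len_split W V n Y : Len W V n -> idl W -> idl Y -> W `<=` Y -> Y `<=` V ->
  exists a b, [/\ Len W Y a, Len Y V b & (n = a + b)%N].
Proof.
move=> WV iW iY WY YV.
by have := Len_meet WV iW iY WY; rewrite (setIidr YV).
Qed.

Lemma Len_pos W V n : Len W V n -> ~ (V `<=` W) -> (0 < n)%N.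
Proof. by case=> // {}W []. Qed.

Lemma Len_chain W V n k (c : nat -> set A) : Len W V n -> idl W ->
  (forall i, (i <= k)%N -> idl (c i)) -> (forall i, (i < k)%N -> c i `<` c i.+1) ->
  W `<=` c 0%N -> c k `<=` V -> (k <= n)%N.
Proof.
elim: k V n => // k IH V n WV iW ic cS Wc cV.
have Wk i : (i <= k.+1)%N -> W `<=` c i.
  elim: i => // i IHi ik z Wz; have [+ _] := cS _ ik; apply.
  exact: (IHi (ltnW ik)).
have [ck _] := cS k (leqnn _).
have [a [b [La Lb ->]]] := Len_split WV iW (ic k (leqnSn _)) (Wk _ (leqnSn _))
   (subset_trans ck cV).
have b0 : (0 < b)%N.
  apply: (Len_pos Lb) => Vc; have [_] := cS k (leqnn _); apply.
  exact: subset_trans cV Vc.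
have := IH _ _ La iW (fun i ik => ic i (leqW ik)) (fun i ik => cS i (leqW ik)) Wc (@subset_refl _ _).
lia.
Qed.

Lemma Len_has_chain W V n : Len W V n -> idl W -> exists c : nat -> set A,
  [/\ c 0%N = W, c n = V, forall i, idl (c i) & forall i, (i < n)%N -> c i `<` c i.+1].
Proof.
elim=> {W V n}[W iW|W X V n u WX IH nXu KX VE iW]; first by exists (fun=> W).
have [c [c0 cn ic cS]] := IH iW.
have iX : idl X := Len_idl WX iW.
exists (fun i => if (i <= n)%N then c i else V); split=> //.
- by rewrite ltnn.
- by move=> i; case: ifP => // _; exact: step_idl VE.
move=> i /ltnSE; rewrite [(i <= n)%N in X in X -> _]leq_eqVlt => /predU1P[->|i_n].
  2: by rewrite (ltnW i_n) i_n; exact: cS.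
rewrite leqnn ltnn cn; split.
  by move=> a Xa; apply/VE; exists 0; rewrite mul0r subr0.
move=> VX; apply: nXu; apply: VX; apply/VE; exists 1.
by rewrite mul1r subrr; exact: idl0.
Qed.

Lemma Len_le W V W' V' n n' : Len W V n -> Len W' V' n' -> idl W -> idl W' ->
  W' `<=` W -> V `<=` V' -> (n <= n')%N.
Proof.
move=> L L' iW iW' WW VV; have [c [c0 cn ic cS]] := Len_has_chain L iW.
by apply: (Len_chain L' iW' (c := c)); rewrite ?c0 ?cn.
Qed.

Lemma Len_uniq W V n n' : Len W V n -> Len W V n' -> idl W -> n = n'.
Proof.
by move=> L L' iW; apply/eqP; rewrite eqn_leq (Len_le L L') // (Len_le L' L).
Qed.

(** Here V = W + (s), and V/W is a finite-dimensional space over A/K. With [s] generating m^n this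
    makes Hilbert functions finite. *)
Lemma Len_gen W (s : seq A) : idl W -> (forall u a, u \in s -> K a -> W (a * u)) ->
  exists V n, [/\ Len W V n, forall u, u \in s -> V u &
    forall Y, idl Y -> W `<=` Y -> (forall u, u \in s -> Y u) -> V `<=` Y].
Proof.
move=> iW; elim: s => [_|u s IH KW]; first by exists W, 0%N; split=> //; exact: Len0.
have [|V [n [L Vs Vmin]]] := IH; first by move=> v a vs; apply: KW; rewrite inE vs orbT.
have iV := Len_idl L iW.
have [Vu|nVu] := pselect (V u).
  exists V, n; split=> // [v|Y iY WY Ys]; first by rewrite inE => /predU1P[->|/Vs].
  by apply: Vmin => // v vs; apply: Ys; rewrite inE vs orbT.
exists (addmul u setT V), n.+1; split.
- apply: (LenS L nVu) => [a Ka|v].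
    by apply: (Len_sub L); apply: KW => //; rewrite inE eqxx.
  by split=> [[a _]|[a Va]]; exists a => //; rewrite mulrC.
- move=> v; rewrite inE => /predU1P[->|/Vs Vv]; last exact: addmulr.
  by rewrite -[X in addmul _ _ _ X]mulr1; exact: addmull.
move=> Y iY WY Ys z [a _ Va].
have VY : V `<=` Y by apply: Vmin => // v vs; apply: Ys; rewrite inE vs orbT.
apply: (idl_sub iY (VY _ Va)); rewrite mulrC; apply: idlM => //.
by apply: Ys; rewrite inE eqxx.
Qed.

Definition ell W V : nat := xget 0%N [set n | Len W V n].

Lemma ellE W V n : Len W V n -> idl W -> ell W V = n.
Proof.
by move=> L iW; rewrite /ell; case: xgetP => [k _ /= Lk|/(_ n)] //; exact: Len_uniq Lk L iW.
Qed.

End Length.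
(** * Ascending chains *)

(** Stated for a relation on any type, so that it covers ideals, sequences of ideals, and pairs
    [(e, f)] compared through an ideal attached to them. *)
Definition chain_stops (T : Type) (Q : T -> Prop) (R : T -> T -> Prop) :=
  forall c : nat -> T, (forall i, Q (c i)) -> (forall i, R (c i) (c i.+1)) ->
    exists i, R (c i.+1) (c i).

Lemma chain_stops_max (T : Type) (Q S : T -> Prop) (R : T -> T -> Prop) x0 :
  chain_stops Q R -> (forall x, S x -> Q x) -> S x0 ->
  exists x, S x /\ forall y, S y -> R x y -> R y x.
Proof.
move=> stop SQ Sx0; apply: contrapT => nmax.
have step x : exists y, S x -> [/\ S y, R x y & ~ R y x].
  have [Sx|nSx] := pselect (S x); last by exists x.
  apply: contrapT => nstep; apply: nmax; exists x; split=> // y Sy Rxy.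
  by apply: contrapT => nRyx; apply: nstep; exists y.
have [f fP] := choice step.
have Sf i : S (iter i f x0) by elim: i => //= i /fP[].
have [i /=] := stop (fun i => iter i f x0) (fun i => SQ _ (Sf i))
  (fun i => let: And3 _ Rxy _ := fP _ (Sf i) in Rxy).
by have [_ _] := fP _ (Sf i).
Qed.

Definition acc (A : comNzRingType) :=
  forall c : nat -> set A, (forall i, idl (c i)) -> (forall i, c i `<=` c i.+1) ->
    exists N, forall i, (N <= i)%N -> c i `<=` c N.

Lemma chain_mono (T : Type) (c : nat -> set T) : (forall i, c i `<=` c i.+1) ->
  forall i j, (i <= j)%N -> c i `<=` c j.
Proof.
move=> cS i j; elim: j => [|j IH]; first by rewrite leqn0 => /eqP->.
rewrite leq_eqVlt => /predU1P[->//|]; rewrite ltnS => /IH ij.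
exact: subset_trans (cS j).
Qed.

Lemma acc_stops (A : comNzRingType) : acc A ->
  chain_stops (@idl A) (fun I J => I `<=` J).
Proof.
by move=> Aacc c ic cS; have [N cN] := Aacc c ic cS; exists N; exact: cN.
Qed.

Lemma idl_is_ideal (A : comNzRingType) (I : set A) : idl I -> is_ideal I.
Proof.
move=> [I0 IP]; split; first by rewrite inE.
by move=> a u v; rewrite !inE; exact: IP.
Qed.

Lemma ideal_gen_mem (A : comNzRingType) (S : set A) u : S u -> u \in ideal_gen S.
Proof.
move=> Su; apply/asboolP; exists [:: (1, u)]; last by rewrite big_seq1 mul1r.
by move=> z; rewrite inE => /eqP->.
Qed.

Lemma ideal_gen_min (A : comNzRingType) (S I : set A) u : idl I -> S `<=` I ->
  u \in ideal_gen S -> I u.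
Proof.
move=> iI SI /asboolP[t tS ->]; rewrite big_seq.
apply: (big_ind I) => [|a b|z zt]; [exact: idl0 | exact: idlD |].
by apply: idlM => //; apply: SI; exact: tS.
Qed.

Lemma idl_ideal_gen (A : comNzRingType) (S : set A) : idl [set` ideal_gen S].
Proof.
split=> [|a u v] /=; first exact: (@rpred0 A^o (ideal_gen S)).
move=> Su Sv; apply: (@rpredD A^o (ideal_gen S)) => //.
exact: (@rpredZ A A^o (ideal_gen S)).
Qed.

Lemma noetherian_gen (A : comNzRingType) (I : set A) : noetherian A -> idl I ->
  exists s : seq A, (forall u, u \in s -> I u) /\
    forall J, idl J -> (forall u, u \in s -> J u) -> I `<=` J.
Proof.
move=> /(_ I) + iI => /(_ (idl_is_ideal iI))[s IE]; exists s; split.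
  by move=> u us; rewrite IE; exact: ideal_gen_mem.
by move=> J iJ sJ u; rewrite IE /=; exact: ideal_gen_min.
Qed.

Lemma noetherian_acc (A : comNzRingType) : noetherian A -> acc A.
Proof.
move=> noeth c ic cS; have cM := chain_mono cS.
have iU : idl (\bigcup_i c i).
  split; first by exists 0%N => //; exact: idl0.
  move=> a u v [i _ ci] [j _ cj]; exists (maxn i j) => //.
  apply: idlD => //; first by apply: idlM => //; apply: (cM i) => //; exact: leq_maxl.
  by apply: (cM j) => //; exact: leq_maxr.
have [s [sU Umin]] := noetherian_gen noeth iU.
have [N sN] : exists N, forall u, u \in s -> c N u.
  elim: s sU {Umin} => [|u s IH] sU; first by exists 0%N.
  have [|N sN] := IH; first by move=> v vs; apply: sU; rewrite inE vs orbT.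
  have [i _ ci] : (\bigcup_i c i) u by apply: sU; rewrite inE eqxx.
  exists (maxn i N) => v; rewrite inE => /predU1P[->|/sN].
    by apply: (cM i) => //; exact: leq_maxl.
  by apply: cM; exact: leq_maxr.
exists N => i _ u cu; apply: (Umin (c N)) => //; by exists i.
Qed.

(** * Hilbert's basis theorem *)

Section HilbertBasis.
Variables (R : comNzRingType) (Racc : acc R).

Definition lead_set (I : set {poly R}) n : set R :=
  [set c | exists p, [/\ I p, (size p <= n.+1)%N & p`_n = c]].

Lemma idl_lead_set I n : idl I -> idl (lead_set I n).
Proof.
move=> iI; split.
  by exists 0; rewrite size_poly0 coef0; split=> //; exact: idl0.
move=> a u v [p [Ip sp <-]] [q [Iq sq <-]]; exists (a%:P * p + q); split.
- by case: iI => _; apply.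
- by rewrite (leq_trans (size_polyD _ _)) // geq_max sq mul_polyC (leq_trans (size_scale_leq _ _)).
- by rewrite coefD coefCM.
Qed.

Lemma lead_setS I n : idl I -> lead_set I n `<=` lead_set I n.+1.
Proof.
move=> iI c [p [Ip sp <-]]; exists ('X * p); split.
- exact: idlM.
- by rewrite mulrC; case: (eqVneq p 0) => [->|p0]; rewrite ?mul0r ?size_poly0 ?size_mulX.
- by rewrite coefXM.
Qed.

Lemma lead_set_eq I J : idl I -> idl J -> I `<=` J ->
  (forall n, lead_set J n `<=` lead_set I n) -> J `<=` I.
Proof.
move=> iI iJ IJ le p; have [n] := ubnP (size p); elim: n p => // n IH p.
rewrite ltnS => sp Jp; case: n => [|n] in IH sp *.
  by move: sp; rewrite leqn0 size_poly_eq0 => /eqP->; exact: idl0.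
have [q [Iq sq qp]] : lead_set I n p`_n by apply: le; exists p.
apply: (idl_sub iI (v := q)) => //; apply: IH; last by apply: idlB => //; exact: IJ.
rewrite ltnS; apply/leq_sizeP => j; rewrite leq_eqVlt coefB => /predU1P[<-|nj].
  by rewrite qp subrr.
by rewrite !(nth_default 0) ?subrr //; apply: leq_trans nj.
Qed.

Lemma hilbert_basis : acc {poly R}.
Proof.
move=> c ic cS; have cM := chain_mono cS.
have leM i j n k : (i <= j)%N -> (n <= k)%N -> lead_set (c i) n `<=` lead_set (c j) k.
  move=> ij nk; apply: (@subset_trans _ (lead_set (c i) k)).
    apply: (chain_mono (c := lead_set (c i))) => // l; exact: lead_setS.
  by move=> a [p [cp sp pa]]; exists p; split=> //; exact: (cM i).
(* The diagonal chain settles all degrees n >= N at once; the finitely many degrees below N are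
   settled one by one. *)
have [N cN] := Racc (fun i => idl_lead_set i (ic i)) (fun i => leM i i.+1 i i.+1 (leqnSn _) (leqnSn _)).
have fixN n : exists M, forall j, (M <= j)%N -> lead_set (c j) n `<=` lead_set (c M) n.
  exact: (Racc (fun i => idl_lead_set n (ic i)) (fun i => leM i i.+1 n n (leqnSn _) (leqnn _))).
have [M MP] : exists M, forall n j, (n < N)%N -> (M <= j)%N -> lead_set (c j) n `<=` lead_set (c M) n.
  elim: N {cN} => [|N [M MP]]; first by exists 0%N.
  have [M' M'P] := fixN N; exists (maxn M M') => n j nN Mj a la.
  move: Mj; rewrite geq_max => /andP[Mj M'j].
  move: nN; rewrite ltnS leq_eqVlt => /predU1P[nN|nN].
    by move: la; rewrite nN => /(M'P _ M'j); apply: leM => //; exact: leq_maxr.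
  by move/(MP _ _ nN Mj): la; apply: leM => //; exact: leq_maxl.
exists (maxn M N) => i; rewrite geq_max => /andP[Mi Ni].
apply: lead_set_eq => //; first by apply: cM; rewrite geq_max Mi.
move=> n; have [nN|Nn] := ltnP n N.
  by apply: (subset_trans (MP _ _ nN Mi)); apply: leM => //; exact: leq_maxl.
apply: (@subset_trans _ (lead_set (c N) N)); last by apply: leM => //; exact: leq_maxr.
apply: (@subset_trans _ (lead_set (c (maxn i n)) (maxn i n))).
  by apply: leM; [exact: leq_maxl | exact: leq_maxr].
by apply: cN; rewrite leq_max Ni.
Qed.

End HilbertBasis.

Inductive subring_gen (R B : comNzRingType) (phi : R -> B) (s : seq B) : B -> Prop :=
| SubringC r : subring_gen phi s (phi r)
| SubringX b : b \in s -> subring_gen phi s b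
| SubringD u v : subring_gen phi s u -> subring_gen phi s v -> subring_gen phi s (u + v)
| SubringM u v : subring_gen phi s u -> subring_gen phi s v -> subring_gen phi s (u * v).

(** Finitely generated algebras are noetherian, without forming the subring as a type: the [c i] are
    modules over it inside B, and their traces on it stabilise. Each generator is absorbed into the
    base ring as an indeterminate. *)
Lemma acc_subring_gen (R B : comNzRingType) (phi : {rmorphism R -> B}) (s : seq B)
    (c : nat -> set B) : acc R ->
  (forall i, c i 0) -> (forall i u v, c i u -> c i v -> c i (u + v)) ->
  (forall i u v, subring_gen phi s u -> c i v -> c i (u * v)) ->
  (forall i, c i `<=` c i.+1) ->
  exists N, forall i, (N <= i)%N -> forall z, subring_gen phi s z -> c i z -> c N z.
Proof.
elim: s R phi => [|b s IH] R phi Racc c0 cD cM cS.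
  have [|i|N cN] := Racc (fun i => phi @^-1` c i).
  - move=> i; split; rewrite /preimage /= ?rmorph0 // => a u v cu cv.
    by rewrite rmorphD rmorphM; apply: cD => //; apply: cM => //; exact: SubringC.
  - by move=> r; exact: cS.
  exists N => i Ni z zs; have [r ->] : exists r, z = phi r; last exact: cN.
    elim: zs => [r|//|u v _ [r ->] _ [t ->]|u v _ [r ->] _ [t ->]].
    - by exists r.
    - by exists (r + t); rewrite rmorphD.
    - by exists (r * t); rewrite rmorphM.
have cfu : commr_rmorph phi b by move=> r; exact: mulrC.
have sub1 z : subring_gen (horner_morph cfu) s z -> subring_gen phi (b :: s) z.
  elim=> [p|u us|u v _ ? _ ?|u v _ ? _ ?]; [|by apply: SubringX; rewrite inE us orbT|exact: SubringD|exact: SubringM].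
  elim/poly_ind: p => [|p r IHp]; first by rewrite rmorph0 -(rmorph0 phi); exact: SubringC.
  rewrite rmorphD rmorphM /= horner_morphX horner_morphC; apply: SubringD; last exact: SubringC.
  by apply: SubringM => //; apply: SubringX; rewrite inE eqxx.
have sub2 z : subring_gen phi (b :: s) z -> subring_gen (horner_morph cfu) s z.
  elim=> [r|u|u v _ ? _ ?|u v _ ? _ ?]; [| |exact: SubringD|exact: SubringM].
    by rewrite -(horner_morphC cfu); exact: SubringC.
  rewrite inE => /predU1P[->|us]; last exact: SubringX.
  by have := SubringC (horner_morph cfu) s 'X; rewrite horner_morphX.
have [|N cN] := IH _ (horner_morph cfu) (hilbert_basis Racc) c0 cD _ cS.
  by move=> i u v /sub1; exact: cM.
by exists N => i Ni z /sub2; exact: cN.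
Qed.
(** * Powers of the maximal ideal *)

Lemma idealr_closedP (A : comNzRingType) (I : set A) :
  idealr_closed [in I] <-> idl I /\ ~ I 1.
Proof.
split=> [[I0 I1 IP]|[[I0 IP] I1]].
  split; first split; rewrite ?inE // in I0 *.
    by move=> a u v Iu Iv; have := IP a u v; rewrite !inE; apply.
  by move: I1; rewrite notin_setE.
split; rewrite ?inE // ?notin_setE // => a u v.
by rewrite !inE; exact: IP.
Qed.

Lemma is_primeP (A : comNzRingType) (P : set A) :
  is_prime P <-> [/\ idl P, ~ P 1 & forall a b, P (a * b) -> P a \/ P b].
Proof.
split=> [[/idealr_closedP[iP P1] pP]|[iP P1 pP]].
  split=> // a b Pab; have := pP a b; rewrite !inE => /(_ Pab).
  by case/orP; rewrite inE; [left|right].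
split; first exact/idealr_closedP.
move=> a b; rewrite inE => /pP Pab; apply/orP.
by case: Pab; rewrite -inE; [left|right].
Qed.

Lemma local_unit (A : comNzRingType) (m : {pred A}) a : noetherian A -> is_local m ->
  a \notin m -> exists b, b * a = 1.
Proof.
move=> /noetherian_acc/acc_stops stop [_ mmax] am; apply: contrapT => na.
(* A maximal member of this family is a maximal ideal, hence m; noetherianity replaces Zorn's
   lemma. *)
pose S (I : set A) := [/\ idl I, ~ I 1 & I a].
have [||I [[iI I1 Ia] Imax]] := chain_stops_max (S := S) (x0 := addmul a setT [set 0]) stop.
- by move=> I [].
- split.
  + apply: idl_addmul; first exact: idlT.
    by split=> // c u v -> ->; rewrite mulr0 addr0.
  + by move=> [b _ /eqP]; rewrite subr_eq0 mulrC => /eqP /esym ba; apply: na; exists b.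
  + by exists 1; rewrite //= mulr1 subrr.
have IE : I = [set` m].
  apply: mmax; split; first exact/idealr_closedP.
  move=> J /idealr_closedP[iJ J1] IJ; apply/seteqP; split=> //.
  by apply: Imax => //; split=> //; exact: IJ.
by move: Ia; rewrite IE /= (negPf am).
Qed.

Section Powers.
Variables (A : comNzRingType) (m : idealr A).

Definition pw n : set A := [set` ideal_pow m n].

Lemma idl_pw n : idl (pw n).
Proof. exact: idl_ideal_gen. Qed.

Lemma pw0 a : pw 0 a.
Proof. exact: ideal_pow_full. Qed.

Lemma pw1 a : pw 1 a <-> a \in m.
Proof. by rewrite /pw /= ideal_pow1. Qed.

Lemma pwM i j a b : pw i a -> pw j b -> pw (i + j) (a * b).
Proof. exact: ideal_powM. Qed.

Lemma pwX i k a : pw i a -> pw (i * k) (a ^+ k).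
Proof.
move=> ai; elim: k => [|k IH]; first by rewrite muln0; exact: pw0.
by rewrite mulnS exprS; exact: pwM.
Qed.

Lemma pw_le i j : (i <= j)%N -> pw j `<=` pw i.
Proof.
move=> ij; rewrite -(subnK ij); elim: (j - i)%N => // k IH a.
by rewrite addSn => /ideal_powS; exact: IH.
Qed.

Lemma pw_ind n (Y : set A) : idl Y -> (forall a b, pw 1 a -> pw n b -> Y (a * b)) ->
  pw n.+1 `<=` Y.
Proof.
move=> iY Yab u; apply: ideal_gen_min => // _ [v vm <-].
rewrite big_ord_recl; apply: Yab; first by apply/pw1; exact: vm.
by apply: ideal_pow_prod => i; exact: vm.
Qed.

(* The homogeneous ideal [\bigoplus_n Y n 'X^n] of the Rees algebra. *)
Definition rgid (Y : nat -> set A) := forall n, [/\ idl (Y n), Y n `<=` pw n &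
  forall a z, pw 1 a -> Y n z -> Y n.+1 (a * z)].

Lemma rgidM Y i n a z : rgid Y -> pw i a -> Y n z -> Y (i + n)%N (a * z).
Proof.
move=> gY; elim: i n a z => [|i IH] n a z.
  by move=> _ Yz; apply: idlM => //; have [] := gY n.
move=> ia Yz; have iC : idl (colon (Y (i.+1 + n)%N) z).
  by apply: idl_colon; have [] := gY (i.+1 + n)%N.
rewrite mulrC; apply: (pw_ind iC _ ia) => b c b1 ci; rewrite /colon /= mulrC -mulrA.
by rewrite addSn; have [_ _] := gY (i + n)%N; apply=> //; exact: IH.
Qed.

Hypothesis A_noetherian : noetherian A.

(** The Rees algebra is generated over A by the x 'X with x in a finite set of generators of m,
    hence is noetherian. *)
Lemma rgid_acc (c : nat -> nat -> set A) : (forall i, rgid (c i)) ->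
  (forall i n, c i n `<=` c i.+1 n) ->
  exists N, forall i n, (N <= i)%N -> c i n `<=` c N n.
Proof.
move=> gc cS.
have ic i n : idl (c i n) by have [] := gc i n.
have [xs [xsm xsmin]] := noetherian_gen A_noetherian (idl_pw 1).
pose s := [seq x *: 'X | x <- xs].
pose c' i := [set p : {poly A} | forall n, c i n p`_n].
have sub p n : subring_gen polyC s p -> pw n p`_n.
  move=> sp; elim: sp n => [r|u /mapP[x /xsm x1 ->]|u v _ pu _ pv|u v _ pu _ pv] n.
  - rewrite coefC; case: n => [|n] /=; [exact: pw0 | exact: (idl0 (idl_pw _))].
  - rewrite coefZ coefX.
    case: n => [|[|n]]; rewrite ?mulr1 ?mulr0 //; [exact: pw0 | exact: (idl0 (idl_pw _))].
  - by rewrite coefD; apply: (idlD (idl_pw n)).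
  - rewrite coefM; apply: (idl_sum _ (idl_pw n)) => j.
    by rewrite -[n in pw n](subnKC (leq_ord j)); exact: pwM.
have gen n a : pw n a -> subring_gen polyC s (a *: 'X^n).
  have g1 b : pw 1 b -> subring_gen polyC s (b *: 'X).
    apply: (xsmin [set b | subring_gen polyC s (b *: 'X)]); last first.
      by move=> x xxs; apply: SubringX; exact: map_f.
    split=> [|e u v su sv] /=; first by rewrite scale0r -(rmorph0 polyC); exact: SubringC.
    rewrite scalerDl -scalerA -mul_polyC; apply: SubringD => //.
    by apply: SubringM => //; exact: SubringC.
  elim: n a => [|n IH] a; first by rewrite expr0 alg_polyC => _; exact: SubringC.
  apply: (@pw_ind n [set b | subring_gen polyC s (b *: 'X^(n.+1))]).
    split=> [|e u v su sv] /=; first by rewrite scale0r -(rmorph0 polyC); exact: SubringC.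
    rewrite scalerDl -scalerA -mul_polyC; apply: SubringD => //.
    by apply: SubringM => //; exact: SubringC.
  move=> u v u1 vn /=; rewrite exprS.
  rewrite (_ : _ *: _ = (u *: 'X) * (v *: 'X^n)); last by rewrite -scalerAl -scalerAr scalerA.
  by apply: SubringM; [exact: g1 | exact: IH].
have [||||N cN] := acc_subring_gen (s := s) (c := c') (phi := polyC) (noetherian_acc A_noetherian).
- by move=> i n; rewrite coef0; exact: idl0.
- by move=> i u v cu cv n; rewrite coefD; exact: idlD.
- move=> i u v su cv n; rewrite coefM; apply: idl_sum => // j.
  by rewrite -[n in c i n](subnKC (leq_ord j)); apply: rgidM => //; exact: sub.
- by move=> i p cp n; exact: cS.
exists N => i n Ni a ca.
have /(cN i Ni) : subring_gen polyC s (a *: 'X^n).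
  by apply: gen; have [_ + _] := gc i n; apply.
have : c' i (a *: 'X^n).
  move=> k; rewrite coefZ coefXn; case: eqP => [->|_]; first by rewrite mulr1.
  by rewrite mulr0; exact: idl0.
by move=> can /(_ can) /(_ n); rewrite coefZ coefXn eqxx mulr1.
Qed.

(** * The Artin-Rees lemma and Krull's intersection theorem *)

Definition pwmul n (I : set A) : set A :=
  [set` ideal_gen [set z | exists a b, [/\ pw n a, I b & z = a * b]]].

Lemma pwmulS n I a z : pw 1 a -> pwmul n I z -> pwmul n.+1 I (a * z).
Proof.
move=> a1; apply: (@ideal_gen_min _ _ (colon (pwmul n.+1 I) a)).
  by apply: idl_colon; exact: idl_ideal_gen.
move=> _ [u [v [un Iv ->]]]; rewrite /colon /= mulrA; apply: ideal_gen_mem.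
by exists (a * u), v; split=> //; exact: (pwM a1 un).
Qed.

(** The homogeneous ideals [Y c] generated by the I ∩ m^k with k <= c form a chain that stops at
    some N, so all I ∩ m^n come from degrees at most N. *)
Lemma artin_rees (I : set A) : idl I ->
  exists c, forall n z, I z -> pw (n + c) z -> pwmul n I z.
Proof.
move=> iI.
have iMp n : idl (pwmul n I) by exact: idl_ideal_gen.
pose Y c n : set A := [set z | forall J, rgid J ->
  (forall k, (k <= c)%N -> I `&` pw k `<=` J k) -> J n z].
have gpw : rgid pw.
  move=> n; split=> //; [exact: idl_pw | move=> a z a1 zn; exact: (pwM a1 zn)].
have [|c n z Yz J gJ IJ|N YN] := @rgid_acc Y.
- move=> c n; split.
  + split=> [J /(_ n)[] /idl0 //|a u v Yu Yv J gJ IJ].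
    have [iJ _ _] := gJ n; apply: idlD => //; last exact: Yv.
    by apply: idlM => //; exact: Yu.
  + by move=> z; apply=> // k _ a [].
  + move=> a z a1 Yz J gJ IJ; have [_ _ JM] := gJ n; apply: JM => //; exact: Yz.
- by apply: Yz => // k kc; apply: IJ; exact: leqW.
exists N => n z Iz zn.
have : Y N (n + N)%N z.
  apply: (YN (n + N)%N); first exact: leq_addl.
  by move=> J gJ; apply.
(* Test ideal with components m^k ∩ m^(k-N) I; up to degree N the truncated exponent is 0, so it
   contains I ∩ m^k. *)
move=> /(_ (fun k => pw k `&` pwmul (k - N) I)); case=> //; last by rewrite addnK.
  move=> k; split.
  - by apply: idlI => //; exact: idl_pw.
  - by move=> a [].
  - move=> a b a1 [bk bI]; split; first exact: (pwM a1 bk).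
    have [Nk|kN] := leqP N k; first by rewrite subSn //; exact: pwmulS.
    rewrite (eqP (kN : _ == _)); rewrite (eqP (ltnW kN : _ == _)) in bI.
    exact: idlM.
move=> k kN a [Ia ak]; split=> //; rewrite (eqP (kN : _ == _)).
by apply: ideal_gen_mem; exists 1, a; rewrite mul1r; split=> //; exact: pw0.
Qed.

Definition addpw (I : set A) n : set A := [set a | exists2 p, I p & pw n (a - p)].

Lemma idl_addpw I n : idl I -> idl (addpw I n).
Proof.
move=> iI; split; first by exists 0; rewrite ?subrr; apply: idl0 => //; exact: idl_pw.
move=> a u v [p Ip up] [q Iq vq]; exists (a * p + q); first by case: iI => _; apply.
rewrite (_ : _ - _ = a * (u - p) + (v - q)); last by ring.
by case: (idl_pw n) => _; apply.
Qed.

Lemma addpwl I n a : I a -> addpw I n a.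
Proof. by exists a => //; rewrite subrr; exact: (idl0 (idl_pw n)). Qed.

Lemma addpwr I n a : idl I -> pw n a -> addpw I n a.
Proof. by exists 0; [exact: idl0 | rewrite subr0]. Qed.

Hypothesis A_local : is_local m.

Lemma pw_unit a : ~ pw 1 a -> exists b, b * a = 1.
Proof. by move=> na; apply: (local_unit A_noetherian A_local); apply/negP => /pw1. Qed.

Lemma pw1_1 : ~ pw 1 1.
Proof. by move=> /pw1; rewrite idealr1. Qed.

(** Artin-Rees for (b) + J puts b into m b + J, and 1 - u is a unit for u in m. *)
Lemma krull_closure (J : set A) b : idl J -> (forall n, addpw J n b) -> J b.
Proof.
move=> iJ Jb; have iI : idl (addmul b setT J) by apply: idl_addmul => //; exact: idlT.
have [c cP] := artin_rees iI.
have [j Jj bj] := Jb (1 + c)%N.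
have /cP /(_ bj) : addmul b setT J (b - j).
  by exists 1 => //; rewrite mulr1 addrAC subrr sub0r; exact: idlN.
have iK : idl (addmul b (pw 1) J) by apply: idl_addmul => //; exact: idl_pw.
case/(ideal_gen_min iK).
  move=> _ [u [v [u1 [w _ Jv] ->]]]; exists (u * w).
    by rewrite mulrC; apply: (idlM _ (idl_pw 1)).
  by rewrite (_ : _ - _ = u * (v - b * w)); [exact: idlM | ring].
move=> u u1 Jbu.
have [|e eu] := @pw_unit (1 - u).
  move=> u1'; apply: pw1_1; rewrite -(subrK u 1).
  exact: (idlD (idl_pw 1)).
rewrite -[b]mul1r -eu -mulrA; apply: idlM => //.
rewrite (_ : _ * b = (b - j - b * u) + j); last by ring.
exact: idlD.
Qed.

(** Artin-Rees for (y) + P bounds the order lost in dividing by y modulo P. This [c] is the shift of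
    Hilbert functions in [adim_regular] and [Lf_prime_meet]. *)
Lemma colon_addpw (P : set A) y : idl P -> (forall a, P (y * a) -> P a) ->
  exists c, forall n a, addpw P (n + c) (y * a) -> addpw P n a.
Proof.
move=> iP yP; have iI : idl (addmul y setT P) by apply: idl_addmul => //; exact: idlT.
have [c cP] := artin_rees iI; exists c => n a [p Pp yap].
have /cP /(_ yap) : addmul y setT P (y * a - p).
  by exists a => //; rewrite addrAC subrr sub0r; exact: idlN.
have iK : idl (addmul y (pw n) P) by apply: idl_addmul => //; exact: idl_pw.
case/(ideal_gen_min iK).
  move=> _ [u [v [un [w _ Pv] ->]]]; exists (u * w).
    by rewrite mulrC; apply: (idlM _ (idl_pw n)).
  by rewrite (_ : _ - _ = u * (v - y * w)); [exact: idlM | ring].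
move=> u un Pu; exists (a - u); last by rewrite opprB addrC subrK.
apply: yP; rewrite (_ : _ * _ = (y * a - p - y * u) + p); last by ring.
exact: idlD.
Qed.

End Powers.
(** * Numerical polynomials *)

Definition eventually_ge0 (p : {poly rat}) :=
  exists N, forall n, (N <= n)%N -> 0 <= p.[n%:R].

Definition back_diff (e : rat) (p : {poly rat}) := p - (p \Po ('X - e%:P)).

Lemma back_diffE e p x : (back_diff e p).[x] = p.[x] - p.[x - e].
Proof. by rewrite /back_diff hornerD hornerN horner_comp hornerXsubC. Qed.

Lemma back_diff_coef e (p : {poly rat}) n : (size p <= n.+1)%N ->
  (size (back_diff e p) <= n)%N /\ (back_diff e p)`_n.-1 = e * n%:R * p`_n.
Proof.
elim/poly_ind: p n => [|p c IH] n sp.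
  by rewrite /back_diff comp_poly0 subr0 size_poly0 !coef0 mulr0.
have -> : back_diff e (p * 'X + c%:P) = e *: p + back_diff e p * ('X - e%:P).
  by rewrite /back_diff comp_polyD comp_polyM comp_polyX comp_polyC -mul_polyC; ring.
have {}sp : (size p <= n)%N.
  move: sp; rewrite size_MXaddC; case: ifP => // /andP[/eqP-> _] _.
  by rewrite size_poly0.
case: n sp => [|n] sp.
  move: sp; rewrite leqn0 size_poly_eq0 => /eqP->.
  by rewrite /back_diff comp_poly0 subr0 mul0r scaler0 addr0 size_poly0 coef0 mulr0 mul0r.
have [sd cd] := IH n sp; split.
  apply: (leq_trans (size_polyD _ _)); rewrite geq_max.
  rewrite (leq_trans (size_scale_leq _ _)) //=.
  have [->|d0] := eqVneq (back_diff e p) 0; first by rewrite mul0r size_poly0.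
  by rewrite size_Mmonic ?monicXsubC // size_XsubC addn2.
have -> : (p * 'X + c%:P)`_n.+1 = p`_n by rewrite coefD coefMX coefC addr0.
rewrite /= coefD coefZ mulrBr coefB coefMX coefMC (nth_default 0 sd) mul0r subr0.
case: n sp {sd IH} cd => [|n] sp /= cd; first by ring.
by rewrite cd [n.+2%:R]mulrS; ring.
Qed.

Lemma size_back_diff_le e (p : {poly rat}) : (size (back_diff e p) <= (size p).-1)%N.
Proof. by have [] := @back_diff_coef e p (size p).-1 (leqSpred _). Qed.

Lemma size_back_diff e (p : {poly rat}) : e != 0 -> size (back_diff e p) = (size p).-1.
Proof.
move=> e0; apply/eqP; rewrite eqn_leq size_back_diff_le /=.
case E: (size p) => [|[|n]] //=; rewrite ltnNge; apply/negP => sd.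
have [_] := @back_diff_coef e p n.+1 (eq_leq E).
rewrite /= (nth_default 0 sd) => /esym/eqP; rewrite !mulf_eq0 (negPf e0) pnatr_eq0 /=.
by rewrite -[n.+1]/(n.+2.-1) -E -lead_coefE lead_coef_eq0 -size_poly_eq0 E.
Qed.

(** By induction on the degree: the difference of a nonconstant p is eventually at least some e > 0,
    so p grows at least linearly. *)
Lemma eventually_pos (p : {poly rat}) : 0 < lead_coef p ->
  exists e, 0 < e /\ exists N, forall n, (N <= n)%N -> e <= p.[n%:R].
Proof.
have [k] := ubnP (size p); elim: k p => // k IH p; rewrite ltnS => sp lp.
have p0 : p != 0 by apply: contraTneq lp => ->; rewrite lead_coef0 ltxx.
have [s1|s1] := leqP (size p) 1.
  exists (lead_coef p); split=> //; exists 0%N => n _.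
  by rewrite (size1_polyC s1) hornerC lead_coefC.
have sd := size_back_diff p (oner_neq0 rat).
have ld : 0 < lead_coef (back_diff 1 p).
  rewrite lead_coefE sd; have [_ ->] := @back_diff_coef 1 p (size p).-1 (leqSpred _).
  by rewrite mul1r mulr_gt0 // ltr0n; case: (size p) s1 => [|[]].
have [|e [e0 [N NP]]] := IH _ _ ld; first by rewrite sd; case: (size p) sp s1.
(* [D] steps of size e add at least 1, so [C * D] steps starting from p(N) outweigh |p(N)| + 1. *)
pose C := Num.bound (`|p.[N%:R]| + 1) ; pose D := Num.bound (e^-1).
have low i : p.[N%:R] + i%:R * e <= p.[(N + i)%:R].
  elim: i => [|i IHi]; first by rewrite mul0r addr0 addn0.
  have := NP (N + i.+1)%N (leq_addr _ _); rewrite back_diffE.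
  rewrite addnS -[(N + i).+1%:R]natr1 addrK => H.
  by rewrite -natr1 mulrDl mul1r addrA; apply: le_trans (_ : p.[(N + i)%:R] + e <= _); [rewrite lerD2r|rewrite addrC -lerBrDr].
exists 1; split=> //; exists (N + C * D)%N => n nN.
rewrite -(subnKC (leq_trans (leq_addr _ _) nN)); apply: le_trans (low _).
have Ce : C%:R <= (n - N)%:R * e :> rat.
  have De : 1 <= D%:R * e.
    rewrite -ler_pdivrMr // div1r ltW //.
    have := archi_boundP (ltW (_ : 0 < e^-1)); rewrite invr_gt0; exact.
  apply: (@le_trans _ _ (C%:R * (D%:R * e))); first by rewrite ler_peMr.
  rewrite mulrA -natrM; apply: ler_wpM2r; first exact: ltW.
  by rewrite ler_nat leq_subRL // (leq_trans (leq_addr _ _) nN).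
have CP : `|p.[N%:R]| + 1 < C%:R by apply: archi_boundP; rewrite addr_ge0.
have := ler_norm (- p.[N%:R]); rewrite normrN.
move: CP Ce; set u := `|_|; set v := p.[_]; set w := _ * e; lra.
Qed.

Lemma eventually_ge0_lead (p : {poly rat}) : eventually_ge0 p -> 0 <= lead_coef p.
Proof.
move=> [N NP]; rewrite leNgt -oppr_gt0 -lead_coefN; apply/negP => /eventually_pos[e [e0 [M MP]]].
have := MP (maxn M N) (leq_maxl _ _); have := NP (maxn M N) (leq_maxr _ _).
by rewrite hornerN; lra.
Qed.

Lemma eventually_ge0_coef (p : {poly rat}) n : eventually_ge0 p -> (size p <= n.+1)%N -> 0 <= p`_n.
Proof.
move=> /eventually_ge0_lead lp; rewrite leq_eqVlt => /predU1P[sp|sp].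
  by rewrite -[n]/(n.+1.-1) -sp.
by rewrite nth_default.
Qed.

Lemma eventually_ge0_size (p q : {poly rat}) : eventually_ge0 p -> eventually_ge0 (q - p) ->
  (size p <= size q)%N.
Proof.
move=> p0 qp0; rewrite leqNgt; apply/negP => sqp.
have sp1 : size p = (size p).-1.+1 by rewrite prednK // (leq_ltn_trans _ sqp).
have qn : q`_(size p).-1 = 0 by rewrite nth_default // -ltnS -sp1.
have H1 := eventually_ge0_coef p0 (eq_leq sp1).
have := @eventually_ge0_coef (q - p) (size p).-1 qp0; rewrite coefB qn -sp1.
move=> /(_ (leq_trans (size_polyD _ _) _)); rewrite size_polyN geq_max leqnn (ltnW sqp).
move=> /(_ isT); rewrite sub0r oppr_ge0 => H2.
have /eqP : p`_(size p).-1 = 0 by apply/eqP; rewrite eq_le H2.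
by rewrite -lead_coefE lead_coef_eq0 => /eqP p00; move: sqp; rewrite p00 size_poly0.
Qed.

Lemma eventually_eq_poly (p q : {poly rat}) N :
  (forall n, (N <= n)%N -> p.[n%:R] = q.[n%:R]) -> p = q.
Proof.
move=> pq; apply/eqP; rewrite -subr_eq0 -lead_coef_eq0 eq_le.
rewrite -oppr_ge0 -lead_coefN !eventually_ge0_lead //.
  by exists N => n /pq E; rewrite !hornerE E subrr.
by exists N => n /pq E; rewrite !hornerE E subrr oppr0.
Qed.

(** Taking differences D times leaves the constant D! p_D. *)
Lemma int_valued_coef (p : {poly rat}) D N : (size p <= D.+1)%N ->
  (forall n, (N <= n)%N -> p.[n%:R] \is a Num.int) -> D`!%:R * p`_D \is a Num.int.
Proof.
elim: D p N => [|D IH] p N sp pN.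
  by rewrite mul1r; have := pN N (leqnn _); rewrite (size1_polyC sp) hornerC coefC.
have [sd /= cd] := @back_diff_coef 1 p D.+1 sp.
have -> : (D.+1)`!%:R * p`_D.+1 = D`!%:R * (back_diff 1 p)`_D.
  by rewrite cd factS natrM; ring.
apply: (IH _ N.+1 sd) => -[//|n] Nn.
by rewrite back_diffE -natr1 addrK natr1 rpredB // pN // ltnW.
Qed.

Lemma back_diff_onto (q : {poly rat}) : exists p, back_diff 1 p = q.
Proof.
have [k] := ubnP (size q); elim: k q => // k IH q; rewrite ltnS => sq.
case: k => [|k] in IH sq *.
  exists 0; rewrite /back_diff comp_poly0 subr0.
  by move: sq; rewrite leqn0 size_poly_eq0 => /eqP.
pose p := (q`_k / k.+1%:R) *: 'X^(k.+1).
have sp : (size p <= k.+2)%N by rewrite (leq_trans (size_scale_leq _ _)) ?size_polyXn.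
have [sd /= cd] := @back_diff_coef 1 p k.+1 sp.
have [|r rE] := IH (q - back_diff 1 p).
  rewrite ltnS; apply/leq_sizeP => j; rewrite leq_eqVlt coefB => /predU1P[<-|kj].
    rewrite cd /p coefZ coefXn eqxx mulr1 mul1r mulrCA divff ?mulr1 ?subrr //.
    by rewrite pnatr_eq0.
  by rewrite !(nth_default 0) ?subrr //; apply: leq_trans kj.
exists (r + p); rewrite -[RHS](subrK (back_diff 1 p)) -rE /back_diff comp_polyD; ring.
Qed.

Definition ev_poly (h : nat -> nat) (q : {poly rat}) :=
  exists N, forall n, (N <= n)%N -> (h n)%:R = q.[n%:R].

Lemma ev_poly_ge0 h q : ev_poly h q -> eventually_ge0 q.
Proof. by move=> [N NP]; exists N => n /NP <-; rewrite ler0n. Qed.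

Lemma ev_poly_uniq h p q : ev_poly h p -> ev_poly h q -> p = q.
Proof.
move=> [N NP] [M MP]; apply: (@eventually_eq_poly _ _ (maxn N M)) => n.
by rewrite geq_max => /andP[/NP <- /MP <-].
Qed.

Lemma ev_polyD h1 h2 p q : ev_poly h1 p -> ev_poly h2 q ->
  ev_poly (fun n => h1 n + h2 n)%N (p + q).
Proof.
move=> [N NP] [M MP]; exists (maxn N M) => n.
by rewrite geq_max => /andP[/NP E1 /MP E2]; rewrite natrD E1 E2 hornerD.
Qed.

Lemma ev_poly_shift h p k : ev_poly h p -> ev_poly (fun n => h (n - k)%N) (p \Po ('X - k%:R%:P)).
Proof.
move=> [N NP]; exists (N + k)%N => n nk.
by rewrite NP ?leq_subRL; [|lia..]; rewrite horner_comp !hornerE natrB //; lia.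
Qed.

Lemma size_comp_shift (p : {poly rat}) c : size (p \Po ('X - c%:P)) = size p.
Proof.
rewrite size_comp_poly2 // size_XsubC //.
Qed.

Lemma ev_poly_le h1 h2 p q : ev_poly h1 p -> ev_poly h2 q ->
  (exists N, forall n, (N <= n)%N -> (h1 n <= h2 n)%N) -> (size p <= size q)%N.
Proof.
move=> hp hq [L LP]; apply: eventually_ge0_size; first exact: ev_poly_ge0 hp.
move: hp hq => [N NP] [M MP]; exists (maxn L (maxn N M)) => n.
rewrite !geq_max => /and3P[/LP le /NP E1 /MP E2].
by rewrite hornerD hornerN -E1 -E2 subr_ge0 ler_nat.
Qed.

Lemma ev_poly_eq h1 h2 q : ev_poly h1 q ->
  (exists N, forall n, (N <= n)%N -> h2 n = h1 n) -> ev_poly h2 q.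
Proof.
move=> [N NP] [L LP]; exists (maxn N L) => n.
by rewrite geq_max => /andP[/NP <- /LP ->].
Qed.

Lemma ev_poly_back h e q : ev_poly h q -> exists N, forall n, (N <= n)%N ->
  (h n)%:R - (h (n - e)%N)%:R = (back_diff e%:R q).[n%:R].
Proof.
move=> hq; have [N NP] := hq; have [M MP] := ev_poly_shift e hq.
exists (maxn N M) => n; rewrite geq_max => /andP[/NP -> /MP ->].
by rewrite back_diffE horner_comp !hornerE.
Qed.

Lemma ev_poly_integrate h g q : ev_poly g q ->
  (forall n, h n.+1 = h n + g n.+1)%N -> exists p, ev_poly h p /\ back_diff 1 p = q.
Proof.
move=> [N NP] hS; have [p pq] := back_diff_onto q.
pose c := (h N)%:R - p.[N%:R].
exists (p + c%:P); split; last first.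
  by rewrite -pq /back_diff comp_polyD comp_polyC; ring.
exists N => n Nn; rewrite -(subnKC Nn); elim: (n - N)%N => [|k IH].
  by rewrite addn0 hornerD hornerC /c addrC subrK.
rewrite addnS hS natrD IH NP ?leqW ?leq_addr // -pq back_diffE !hornerD !hornerC -natr1 addrK; ring.
Qed.

(** Otherwise the top coefficient of r - (q(X) - q(X - e)) would be a negative multiple of that of
    q, which is positive. *)
Lemma size_back_diff_ge0 (q r : {poly rat}) e : 0 < e -> eventually_ge0 q ->
  eventually_ge0 (r - back_diff e q) -> ((size q).-1 <= size r)%N.
Proof.
move=> e0 q0 rq0; rewrite leqNgt; apply/negP => sr.
case E: (size q) sr => [|[|k]] //= sr.
have [sd /= cd] := @back_diff_coef e q k.+1 (eq_leq E).
have := @eventually_ge0_coef _ k rq0; rewrite coefB cd nth_default // sub0r.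
rewrite (leq_trans (size_polyD _ _)) ?size_polyN ?geq_max ?sd ?leqW //.
move=> /(_ isT); rewrite oppr_ge0 pmulr_rle0 ?mulr_gt0 ?ltr0n // => H.
have H2 := eventually_ge0_coef q0 (eq_leq E).
have : q`_k.+1 == 0 by rewrite eq_le H.
by rewrite -[k.+1]/(k.+2.-1) -E -lead_coefE lead_coef_eq0 -size_poly_eq0 E.
Qed.
(** * Homogeneous ideals of the associated graded ring *)

Section Graded.
Variables (A : comNzRingType) (m : idealr A).
Hypotheses (A_noetherian : noetherian A) (A_local : is_local m).
Local Notation pw := (pw m).
Local Notation Len := (Len (pw 1)).
Implicit Types Z X : nat -> set A.

Let pw_unit := pw_unit A_noetherian A_local.
Let idl_pw n : idl (pw n) := idl_pw m n.

(* The homogeneous ideal [\bigoplus_n Z n / m^(n+1)] of the associated graded ring. *)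
Definition gid Z := rgid m Z /\ forall n, pw n.+1 `<=` Z n.

Lemma gid_idl Z n : gid Z -> idl (Z n).
Proof. by case=> /(_ n)[]. Qed.

Lemma gid_sub Z n : gid Z -> Z n `<=` pw n.
Proof. by case=> /(_ n)[]. Qed.

Lemma gid_pw Z n a : gid Z -> pw n.+1 a -> Z n a.
Proof. by case=> _; apply. Qed.

Lemma gidM Z i n a z : gid Z -> pw i a -> Z n z -> Z (i + n)%N (a * z).
Proof. by case=> gZ _; exact: rgidM. Qed.

Definition gle Z X := forall n, Z n `<=` X n.

Lemma gle_trans Z X Y : gle Z X -> gle X Y -> gle Z Y.
Proof. by move=> ZX XY n a /ZX /XY. Qed.

Lemma gid_stops : chain_stops gid gle.
Proof.
move=> c gc cS; have [N cN] := rgid_acc A_noetherian (fun i => (gc i).1) cS.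
by exists N => n; exact: cN.
Qed.

(* [gadd Z e f] is [Z + (f)] and [gcolon Z e f] is [Z : f], for [f] of degree [e]. *)
Definition gadd Z e f n : set A :=
  if (e <= n)%N then addmul f (pw (n - e)) (Z n) else Z n.

Definition gcolon Z e f n : set A := [set a | pw n a /\ Z (n + e)%N (f * a)].

Lemma gle_gadd Z e f : gle Z (gadd Z e f).
Proof. by move=> n a Za; rewrite /gadd; case: ifP => // _; apply: addmulr. Qed.

Lemma gid_gadd Z e f : gid Z -> pw e f -> gid (gadd Z e f).
Proof.
move=> gZ fe; split=> n; last first.
  by move=> a an; apply: gle_gadd; exact: gid_pw.
rewrite /gadd; split.
- by case: ifP => // _; [apply: idl_addmul => // |]; exact: gid_idl.
- case: ifP => en; last exact: gid_sub.
  move=> z [a an /(gid_sub gZ) zn]; apply: (idl_sub _ zn) => //.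
  by rewrite -(subnKC en); exact: pwM.
- move=> a z a1; case: ifP => en; last first.
    move=> Zz; have Zaz : Z n.+1 (a * z) by exact: (gidM gZ a1 Zz).
    by case: ifP => // _; exact: addmulr.
  move=> [b bn Zb]; rewrite (leqW en); exists (a * b).
    by rewrite subSn //; exact: (pwM a1 bn).
  by rewrite mulrCA -mulrBr; exact: (gidM gZ a1 Zb).
Qed.

Lemma gadd_mem Z e f n a : gid Z -> (e <= n)%N -> pw (n - e) a -> gadd Z e f n (f * a).
Proof. by move=> gZ en an; rewrite /gadd en; apply: addmull => //; exact: gid_idl. Qed.

Lemma gadd_gen Z e f : gid Z -> gadd Z e f e f.
Proof. by move=> gZ; rewrite -[X in gadd _ _ _ _ X]mulr1; apply: gadd_mem => //; rewrite subnn; exact: pw0. Qed.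

Lemma gadd_min Z X e f : gid X -> gle Z X -> X e f -> gle (gadd Z e f) X.
Proof.
move=> gX ZX Xf n z; rewrite /gadd; case: ifP => en; last exact: ZX.
move=> [a an /ZX Xz]; apply: (idl_sub _ Xz); first exact: gid_idl.
by rewrite -[n](subnK en) mulrC; apply: gidM.
Qed.

Lemma gle_gcolon Z e f : gid Z -> pw e f -> gle Z (gcolon Z e f).
Proof.
move=> gZ fe n a Za; split; first exact: gid_sub Za.
by rewrite addnC; apply: gidM.
Qed.

Lemma gid_gcolon Z e f : gid Z -> pw e f -> gid (gcolon Z e f).
Proof.
move=> gZ fe; split=> n; last first.
  by move=> a an; apply: gle_gcolon => //; exact: gid_pw.
split.
- by apply: idlI => //; apply: idl_colon; exact: gid_idl.
- by move=> a [].
- move=> a z a1 [zn Zz]; split; first exact: (pwM a1 zn).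
  by rewrite mulrCA; exact: (gidM gZ a1 Zz).
Qed.

Definition hf Z n := ell (pw 1) (Z n) (pw n).

Lemma hfP Z n : gid Z -> Len (Z n) (pw n) (hf Z n).
Proof.
move=> gZ; have iZ := gid_idl n gZ.
have [s [sn smin]] := noetherian_gen A_noetherian (idl_pw n).
have [|V [k [L Vs Vmin]]] := Len_gen (K := pw 1) iZ (s := s).
  by move=> u a /sn un a1; apply: gid_pw => //; exact: (pwM a1 un).
have VE : V = pw n.
  apply/seteqP; split.
    by apply: Vmin => //; exact: gid_sub.
  by apply: smin => //; exact: Len_idl L iZ.
by rewrite VE in L; rewrite /hf (ellE pw_unit L).
Qed.

Lemma hf_le Z X n : gid Z -> gid X -> gle Z X -> (hf X n <= hf Z n)%N.
Proof.
move=> gZ gX ZX; apply: (Len_le pw_unit (hfP n gX) (hfP n gZ)) => //; exact: gid_idl.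
Qed.

(** Lengths in degree n of 0 -> G/(Z : f) -> G/Z -> G/(Z + (f)) -> 0, with the first term shifted by
    e. *)
Lemma hf_gadd Z e f n : gid Z -> pw e f -> (e <= n)%N ->
  hf Z n = (hf (gcolon Z e f) (n - e) + hf (gadd Z e f) n)%N.
Proof.
move=> gZ fe en; have iZ := gid_idl n gZ.
have gC := gid_gcolon gZ fe; have gA := gid_gadd gZ fe.
have := Len_map (f := f) (hfP (n - e) gC) (gid_idl (n - e) gC) iZ.
have -> : addmul f (pw (n - e)) (Z n) = gadd Z e f n by rewrite /gadd en.
move=> H; have {}H : Len (Z n) (gadd Z e f n) (hf (gcolon Z e f) (n - e)).
  by apply: H => a an; rewrite /gcolon /= subnK //; split=> [|[]].
exact: (ellE pw_unit (Len_cat H (hfP n gA)) iZ).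
Qed.

Lemma gid_full Z : gid Z -> Z 0%N 1 -> forall n, pw n `<=` Z n.
Proof. by move=> gZ Z1 n a an; rewrite -[a]mulr1 -[n]addn0; apply: gidM. Qed.

Lemma hf_full Z n : gid Z -> pw n `<=` Z n -> hf Z n = 0%N.
Proof.
move=> gZ nZ; have E : Z n = pw n by apply/seteqP; split=> //; exact: gid_sub.
by rewrite /hf E; apply: (ellE pw_unit) => //; exact: Len0.
Qed.

Lemma hf_eq0 Z n : gid Z -> hf Z n = 0%N -> pw n `<=` Z n.
Proof.
move=> gZ h0; apply: contrapT => nZ.
by have := Len_pos (hfP n gZ) nZ; rewrite h0.
Qed.

(** Let X be maximal without a Hilbert polynomial and x a form of degree one outside X. Then X + (x)
    has one, and so has X : x unless it equals X. In the exceptional case the difference of the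
    Hilbert function of X is that of X + (x), which is summed. *)
Lemma hf_ev_poly Z : gid Z -> exists q, ev_poly (hf Z) q.
Proof.
move=> gZ; apply: contrapT => nq.
have [||X [[gX nX] Xmax]] := chain_stops_max
    (S := fun X => gid X /\ ~ exists q, ev_poly (hf X) q) (x0 := Z) gid_stops.
- by move=> ? [].
- by [].
have big Y : gid Y -> gle X Y -> (exists n a, Y n a /\ ~ X n a) -> exists q, ev_poly (hf Y) q.
  move=> gY XY [n [a [Ya nXa]]]; apply: contrapT => nY.
  by apply: nXa; exact: (Xmax Y _ XY n a Ya).
have [X1|] := pselect (pw 1 `<=` X 1%N).
  apply: nX; exists 0; exists 1%N => -[//|n] _; rewrite horner0 hf_full //.
  apply: pw_ind; first exact: gid_idl.
  by move=> a b a1 bn; rewrite mulrC -addn1; apply: gidM => //; exact: X1.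
move=> /existsNP[x /not_implyP[x1 nXx]].
have gA := gid_gadd gX x1; have gC := gid_gcolon gX x1.
have [q qP] : exists q, ev_poly (hf (gadd X 1 x)) q.
  apply: big => //; first exact: gle_gadd.
  by exists 1%N, x; split=> //; exact: gadd_gen.
have [CX|] := pselect (gle (gcolon X 1 x) X).
  have [] := @ev_poly_integrate (hf X) (hf (gadd X 1 x)) q qP; last first.
    by move=> p [pP _]; apply: nX; exists p.
  move=> n; rewrite [LHS](hf_gadd gX x1) //; congr addn.
  rewrite subSS subn0; apply/eqP; rewrite eqn_leq !hf_le //.
  exact: gle_gcolon.
move=> /existsNP[n /existsNP[a /not_implyP[Ca nXa]]].
have [r rP] : exists q, ev_poly (hf (gcolon X 1 x)) q.
  by apply: big => //; [exact: gle_gcolon | exists n, a].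
apply: nX; exists ((r \Po ('X - 1%:R%:P)) + q).
apply: (ev_poly_eq (ev_polyD (ev_poly_shift 1 rP) qP)).
by exists 1%N => k k1; exact: hf_gadd.
Qed.

Definition gpoly Z : {poly rat} := xget 0 [set q | ev_poly (hf Z) q].

Lemma gpolyP Z : gid Z -> ev_poly (hf Z) (gpoly Z).
Proof.
move=> /hf_ev_poly[q qP]; rewrite /gpoly.
by case: xgetP => [p _ //|/(_ q)].
Qed.

(* The Hilbert polynomial of [G / Z] has degree [dim (G / Z) - 1], and [size] is the degree
   plus one ([0] for the zero polynomial), so this is the Krull dimension of [G / Z]. *)
Definition gdim Z := size (gpoly Z).

Lemma gdim_le Z X : gid Z -> gid X -> gle Z X -> (gdim X <= gdim Z)%N.
Proof.
move=> gZ gX ZX; apply: (ev_poly_le (gpolyP gX) (gpolyP gZ)).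
by exists 0%N => n _; exact: hf_le.
Qed.

Lemma gdim_ext Z X : gid Z -> gid X -> gle Z X -> gle X Z -> gdim X = gdim Z.
Proof. by move=> *; apply/eqP; rewrite eqn_leq !gdim_le. Qed.

Lemma gdim_regular Z e f : gid Z -> pw e f -> (0 < e)%N -> gle (gcolon Z e f) Z ->
  (gdim (gadd Z e f) <= (gdim Z).-1)%N.
Proof.
move=> gZ fe e0 CZ; have gA := gid_gadd gZ fe; have gC := gid_gcolon gZ fe.
rewrite /gdim (_ : gpoly (gadd Z e f) = back_diff e%:R (gpoly Z)) ?size_back_diff_le //.
have [N NP] := ev_poly_back e (gpolyP gZ).
have [M MP] := gpolyP gA.
apply: (@eventually_eq_poly _ _ (maxn e (maxn N M))) => n; rewrite !geq_max => /and3P[en /NP <- /MP <-].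
rewrite (hf_gadd gZ fe en) natrD.
have -> : hf (gcolon Z e f) (n - e) = hf Z (n - e).
  by apply/eqP; rewrite eqn_leq !hf_le //; exact: gle_gcolon.
by rewrite addrAC subrr add0r.
Qed.

Lemma gdim_gadd_colon Z e f : gid Z -> pw e f ->
  (gdim Z <= maxn (gdim (gcolon Z e f)) (gdim (gadd Z e f)))%N.
Proof.
move=> gZ fe; have gA := gid_gadd gZ fe; have gC := gid_gcolon gZ fe.
have H := ev_polyD (ev_poly_shift e (gpolyP gC)) (gpolyP gA).
apply: (leq_trans (ev_poly_le (gpolyP gZ) H _)).
  by exists e => n en; rewrite (hf_gadd gZ fe en).
by rewrite (leq_trans (size_polyD _ _)) // size_comp_shift.
Qed.

Lemma gdim_gadd_ge Z e f : gid Z -> pw e f -> (0 < e)%N ->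
  ((gdim Z).-1 <= gdim (gadd Z e f))%N.
Proof.
move=> gZ fe e0; have gA := gid_gadd gZ fe; have gC := gid_gcolon gZ fe.
apply: (@size_back_diff_ge0 _ _ e%:R); rewrite ?ltr0n //; first exact: ev_poly_ge0 (gpolyP gZ).
have [N NP] := ev_poly_back e (gpolyP gZ).
have [M MP] := gpolyP gA.
exists (maxn e (maxn N M)) => n; rewrite !geq_max => /and3P[en /NP E1 /MP E2].
rewrite hornerD hornerN -E1 -E2 (hf_gadd gZ fe en) natrD.
have : (hf (gcolon Z e f) (n - e) <= hf Z (n - e))%N by apply: hf_le => //; exact: gle_gcolon.
by rewrite -(ler_nat rat); lra.
Qed.

Lemma gdim_eq0 Z : gid Z -> (exists N, forall n, (N <= n)%N -> pw n `<=` Z n) -> gdim Z = 0%N.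
Proof.
move=> gZ [N NP]; rewrite /gdim (_ : gpoly Z = 0) ?size_poly0 //.
apply: (ev_poly_uniq (gpolyP gZ)); exists N => n /NP nZ.
by rewrite hf_full // horner0.
Qed.

Lemma gdim_eq0_full Z : gid Z -> gdim Z = 0%N ->
  exists N, forall n, (N <= n)%N -> pw n `<=` Z n.
Proof.
move=> gZ /eqP; rewrite size_poly_eq0 => /eqP q0.
have [N NP] := gpolyP gZ; exists N => n /NP; rewrite q0 horner0 => /eqP.
by rewrite pnatr_eq0 => /eqP; exact: hf_eq0.
Qed.

Definition gprime Z := [/\ gid Z, ~ Z 0%N 1 &
  forall i j a b, pw i a -> pw j b -> Z (i + j)%N (a * b) -> Z i a \/ Z j b].

(** An ideal Z maximal among those above X of dimension at least t is prime: if ab lies in Z but a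
    and b do not, then Z : a and Z + (a) are larger, so of dimension below t, against
    [gdim_gadd_colon]. *)
Lemma gprime_above X t : gid X -> (0 < t <= gdim X)%N ->
  exists p, [/\ gprime p, gle X p & (t <= gdim p)%N].
Proof.
move=> gX /andP[t0 tX].
have [||Z [[gZ XZ tZ] Zmax]] := chain_stops_max
    (S := fun Z => [/\ gid Z, gle X Z & (t <= gdim Z)%N]) (x0 := X) gid_stops.
- by move=> ? [].
- by split=> // n a.
exists Z; split=> //; split=> //.
  move=> Z1; have : gdim Z = 0%N by apply: gdim_eq0 => //; exists 0%N => n _; exact: gid_full.
  by move=> Z0; move: tZ; rewrite Z0 leqNgt t0.
move=> i j a b ai bj Zab; apply: contrapT => /not_orP[nZa nZb].
have gA := gid_gadd gZ ai; have gC := gid_gcolon gZ ai.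
have big Y : gid Y -> gle Z Y -> (exists n c, Y n c /\ ~ Z n c) -> (gdim Y < t)%N.
  move=> gY ZY [n [c [Yc nZc]]]; rewrite ltnNge; apply/negP => tY.
  by apply: nZc; apply: (Zmax Y) => //; split=> //; exact: gle_trans ZY.
have dC : (gdim (gcolon Z i a) < t)%N.
  apply: big => //; first exact: gle_gcolon.
  by exists j, b; split=> //; split=> //; rewrite addnC.
have dA : (gdim (gadd Z i a) < t)%N.
  by apply: big => //; [exact: gle_gadd | exists i, a; split=> //; exact: gadd_gen].
have := leq_trans tZ (gdim_gadd_colon gZ ai).
by rewrite leqNgt gtn_max dC dA.
Qed.

Lemma gprimeX p i a k : gprime p -> pw i a -> p (i * k)%N (a ^+ k) -> p i a.
Proof.
move=> [gp p1 pp] ai; elim: k => [|k IH].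
  by rewrite muln0 expr0 => /p1.
rewrite mulnS exprS => /pp[] //.
exact: pwX.
Qed.

End Graded.
(** * Homogeneous systems of parameters *)

Section HomogParams.
Variables (A : comNzRingType) (m : idealr A).
Hypotheses (A_noetherian : noetherian A) (A_local : is_local m).
Local Notation pw := (pw m).
Local Notation gid := (gid m).
Local Notation gadd := (gadd m).
Local Notation gcolon := (gcolon m).
Local Notation gdim := (gdim m).
Implicit Types Z X : nat -> set A.

Let idl_pw n : idl (pw n) := idl_pw m n.

(* [Z : f^oo] *)
Definition gsat Z e f n : set A := [set u | pw n u /\ exists k, Z (n + e * k)%N (u * f ^+ k)].

Lemma gsat_le Z e f n u k l : gid Z -> pw e f -> (k <= l)%N ->
  Z (n + e * k)%N (u * f ^+ k) -> Z (n + e * l)%N (u * f ^+ l).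
Proof.
move=> gZ fe kl Zk; rewrite -(subnKC kl) exprD mulrA mulnDr addnA addnC mulrC.
by apply: (gidM gZ) => //; exact: pwX.
Qed.

Lemma gid_gsat Z e f : gid Z -> pw e f -> gid (gsat Z e f).
Proof.
move=> gZ fe; split=> n; last first.
  move=> a an; split; first exact: pw_le an.
  by exists 0%N; rewrite muln0 addn0 mulr1; exact: (gid_pw gZ).
split.
- split; first by split; [exact: idl0 | exists 0%N; rewrite mul0r; apply: idl0; exact: (gid_idl _ gZ)].
  move=> a u v [un [k Zu]] [vn [l Zv]]; split; first by case: (idl_pw n) => _; apply.
  exists (maxn k l); rewrite mulrDl -mulrA.
  apply: idlD; [exact: (gid_idl _ gZ)| |].
    by apply: idlM; [exact: (gid_idl _ gZ) | apply: gsat_le Zu => //; exact: leq_maxl].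
  by apply: gsat_le Zv => //; exact: leq_maxr.
- by move=> a [].
- move=> a z a1 [zn [k Zz]]; split; first exact: (pwM a1 zn).
  by exists k; rewrite -mulrA; exact: (gidM gZ a1 Zz).
Qed.

Definition gann Z Y n : set A :=
  [set a | pw n a /\ forall j u, Y j u -> Z (n + j)%N (a * u)].

Lemma gid_gann Z Y : gid Z -> (forall j, Y j `<=` pw j) -> gid (gann Z Y).
Proof.
move=> gZ Ypw; split=> n; last first.
  move=> a an; split; first exact: pw_le an.
  by move=> j u /Ypw uj; apply: (gid_pw gZ) => //; exact: (pwM an uj).
split.
- split; first by split=> [|j u _]; rewrite ?mul0r; apply: idl0 => //; exact: (gid_idl _ gZ).
  move=> a u v [un Zu] [vn Zv]; split; first by case: (idl_pw n) => _; apply.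
  move=> j w Yw; rewrite mulrDl -mulrA; apply: idlD; first exact: (gid_idl _ gZ).
    by apply: idlM; [exact: (gid_idl _ gZ) | exact: Zu].
  exact: Zv.
- by move=> a [].
- move=> a z a1 [zn Zz]; split; first exact: (pwM a1 zn).
  by move=> j u Yu; rewrite -mulrA; exact: (gidM gZ a1 (Zz _ _ Yu)).
Qed.

Lemma gidX Z e f k : gid Z -> Z e f -> Z (e * k.+1)%N (f ^+ k.+1).
Proof.
by move=> gZ Zf; rewrite exprSr mulnS addnC; apply: (gidM gZ) => //; apply: pwX; exact: gid_sub Zf.
Qed.

(* Prime avoidance without a primary decomposition: take [f] in [a] making the annihilator of
   [(Z : f^oo) / Z] maximal. An [h] in the intersection of [a] and [Z : f^oo] has
   [Z : (f^s + h^t)^oo] inside [Z : h^oo], so by maximality [h] is nilpotent modulo [Z]. A prime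
   of large dimension over [Z + (f)] would then contain [a] or [Z : f^oo]. *)
Lemma gdim_avoid Z a D : gid Z -> gid a -> a 0%N `<=` pw 1 ->
  (gdim Z <= D.+1)%N -> (gdim a <= D)%N ->
  exists e f, [/\ (0 < e)%N, a e f & (gdim (gadd Z e f) <= D)%N].
Proof.
move=> gZ ga a0 dZ da.
pose B (p : nat * A) := gann Z (gsat Z p.1 p.2).
pose S (p : nat * A) := (0 < p.1)%N /\ a p.1 p.2.
have gB p : S p -> gid (B p).
  by move=> _; apply: gid_gann => // j u [].
have stop : chain_stops S (fun p q => gle (B p) (B q)).
  by move=> c Sc; exact: (gid_stops A_noetherian (fun i => gB _ (Sc i))).
have [||[e f] [[/= e0 af] fmax]] := chain_stops_max (S := S) (x0 := (1%N, 0)) stop.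
- by [].
- by split=> //; apply: idl0; exact: (gid_idl _ ga).
have fe := gid_sub ga af.
have gY := gid_gsat gZ fe.
exists e, f; split=> //; rewrite leqNgt; apply/negP => dA.
have nil j h : (0 < j)%N -> gsat Z e f j h -> a j h -> exists k, Z (j * k)%N (h ^+ k).
  move=> j0 Yh ah; have [hj [N Zh]] := Yh.
  (* These exponents make f^s and h^t forms of the same degree, and s > N gives h f^s in Z. *)
  pose s := (j * N.+1)%N; pose t := (e * N.+1)%N.
  pose e' := (e * s)%N; pose f' := f ^+ s + h ^+ t.
  have e'E : e' = (j * t)%N by rewrite /e' /s /t; ring.
  have s0 : (0 < s)%N by rewrite muln_gt0 j0.
  have t0 : (0 < t)%N by rewrite muln_gt0 e0.
  have af' : a e' f'.
    apply: idlD; first exact: (gid_idl _ ga).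
      by rewrite /e' -(prednK s0); exact: (gidX _ ga).
    by rewrite e'E -(prednK t0); exact: (gidX _ ga).
  have fe' := gid_sub ga af'.
  (* As h f^N lies in Z, multiplying by powers of f or of h separates the two summands of f': modulo
     Z, if f'^M kills u then so do a power of f and a power of h. *)
  have kill n u M : pw n u -> Z (n + e' * M)%N (u * f' ^+ M) ->
      Z (n + e' * M + e * N)%N (u * f ^+ (s * M + N)) /\
      Z (n + e' * M + j)%N (u * h ^+ (t * M + 1)).
    elim: M n u => [|M IH] n u un.
      rewrite !muln0 !addn0 mulr1 !add0n expr1 => Zu; split.
        by rewrite addnC mulrC; apply: (gidM gZ) => //; exact: pwX.
      by rewrite addnC mulrC; exact: (gidM gZ).
    rewrite mulnS addnA exprS mulrA => Zu.
    have [Z1 Z2] := IH _ _ (pwM un fe') Zu; split.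
      have Z3 : Z (n + e' + e' * M + e * N)%N (u * h ^+ t * f ^+ (s * M + N)).
        rewrite (_ : _ * _ = (u * h ^+ t.-1 * f ^+ (s * M)) * (h * f ^+ N)); last first.
          by rewrite -[in LHS](prednK t0) exprS exprD; ring.
        have -> : (n + e' + e' * M + e * N = n + j * t.-1 + e * (s * M) + (j + e * N))%N.
          by rewrite {1}e'E -[in (j * t)%N](prednK t0) /e'; ring.
        by apply: (gidM gZ) => //; apply: pwM; [apply: pwM => //|]; exact: pwX.
      rewrite (_ : u * _ = u * f' * f ^+ (s * M + N) - u * h ^+ t * f ^+ (s * M + N)).
        by apply: idlB => //; exact: (gid_idl _ gZ).
      by rewrite /f' mulnS -addnA exprD; ring.
    have Z3 : Z (n + e' + e' * M + j)%N (u * f ^+ s * h ^+ (t * M + 1)).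
      have sE : s = (s - N + N)%N by rewrite subnK // /s; nia.
      rewrite (_ : _ * _ = (u * f ^+ (s - N) * h ^+ (t * M)) * (h * f ^+ N)); last first.
        by rewrite [in LHS]sE !exprD expr1; ring.
      have -> : (n + e' + e' * M + j = n + e * (s - N) + j * (t * M) + (j + e * N))%N.
        by rewrite mulnA -e'E /e' {1}sE; ring.
      by apply: (gidM gZ) => //; apply: pwM; [apply: pwM => //|]; exact: pwX.
    rewrite (_ : u * _ = u * f' * h ^+ (t * M + 1) - u * f ^+ s * h ^+ (t * M + 1)).
      by apply: idlB => //; exact: (gid_idl _ gZ).
    by rewrite /f' mulnS -addnA [in LHS]exprD; ring.
  have Yle : gle (gsat Z e' f') (gsat Z e f).
    move=> n u [un [M Zu]]; split=> //; have [H _] := kill n u M un Zu.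
    exists (s * M + N)%N; move: H; congr (Z _ _).
    by rewrite /e'; ring.
  have [N' stab] : exists N', forall n u, (exists k, pw n u /\ Z (n + j * k)%N (u * h ^+ k)) ->
      Z (n + j * N')%N (u * h ^+ N').
    pose C k := gcolon Z (j * k) (h ^+ k).
    have gC k : gid (C k) by apply: gid_gcolon => //; exact: pwX.
    have [|N' CN] := rgid_acc A_noetherian (fun k => (gC k).1).
      move=> k n u [un Zu]; split=> //; rewrite mulrC in Zu; rewrite mulrC.
      exact: gsat_le Zu.
    exists N' => n u [k [un Zu]].
    suff [_] : C N' n u by rewrite mulrC.
    apply: (CN (maxn k N')); first exact: leq_maxr.
    split=> //; rewrite mulrC; apply: gsat_le Zu => //; exact: leq_maxl.
  have Bh : B (e', f') (j * N')%N (h ^+ N').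
    split; first exact: pwX.
    move=> n u [un [M Zu]]; rewrite addnC mulrC; apply: stab.
    exists (t * M + 1)%N; split=> //; have [_] := kill n u M un Zu.
    by congr (Z _ _); rewrite e'E; ring.
  have Se' : S (e', f') by split; rewrite //= muln_gt0 e0.
  (* The annihilator attached to f' contains that of f, so equals it by maximality. Hence h^N' kills
     the saturation by f, to which h itself belongs. *)
  have [|_ ZB] := fmax (e', f') Se' _ _ _ Bh.
    move=> n u [un Zu]; split=> // k v /Yle; exact: Zu.
  exists N'.+1; rewrite exprSr mulnS addnC; exact: ZB.
have gA := gid_gadd gZ fe.
have [p [pp Ap dp]] := gprime_above A_noetherian A_local gA (t := D.+1) dA.
have [gp p1 pM] := pp.
have Zp : gle Z p by apply: gle_trans Ap; exact: gle_gadd.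
have pf : p e f by apply: Ap; exact: gadd_gen.
have [Yp|] := pselect (gle (gsat Z e f) p).
  have := gdim_le A_noetherian A_local (gid_gadd gY fe) gp (gadd_min gp Yp pf).
  apply/negP; rewrite -ltnNge (leq_trans _ dp) // ltnS.
  apply: (leq_trans (gdim_regular A_noetherian A_local gY fe e0 _)).
    move=> n u [un [fun1 [k Zk]]]; split=> //; exists k.+1.
    by move: Zk; congr (Z _ _); rewrite ?mulnS ?exprS; ring.
  have : (gdim (gsat Z e f) <= gdim Z)%N; last lia.
  apply: gdim_le => // n u Zu; split; first exact: gid_sub Zu.
  by exists 0%N; rewrite muln0 addn0 mulr1.
move=> /existsNP[i /existsNP[u /not_implyP[Yu npu]]].
have ap : gle a p.
  move=> j v av; apply: contrapT => npv.
  have j0 : (0 < j)%N.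
    by rewrite lt0n; apply/eqP => jE; apply: npv; rewrite jE; apply: (gid_pw gp); apply: a0; rewrite -jE.
  have ui := gid_sub gY Yu; have vj := gid_sub ga av.
  have [|||k Zk] := nil (i + j)%N (u * v).
  - by rewrite addn_gt0 j0 orbT.
  - by rewrite mulrC addnC; apply: (gidM gY).
  - exact: (gidM ga).
  have : p (i + j)%N (u * v) by apply: (gprimeX pp (pwM ui vj)); exact: Zp Zk.
  by case/pM.
by have := gdim_le A_noetherian A_local ga gp ap; lia.
Qed.

Definition gadds Z (fs : seq (nat * A)) := foldr (fun p Z => gadd Z p.1 p.2) Z fs.

Definition homog (fs : seq (nat * A)) :=
  forall p, p \in fs -> (0 < p.1)%N /\ pw p.1 p.2.

Lemma homog_cons p fs : homog (p :: fs) -> [/\ (0 < p.1)%N, pw p.1 p.2 & homog fs].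
Proof.
move=> h; have [p0 pp] := h p (mem_head _ _); split=> // q qfs.
by apply: h; rewrite inE qfs orbT.
Qed.

Lemma gid_gadds Z fs : gid Z -> homog fs -> gid (gadds Z fs).
Proof.
move=> gZ; elim: fs => //= p fs IH /homog_cons[p0 pp hfs].
by apply: gid_gadd => //; exact: IH.
Qed.

Lemma gle_gadds Z fs : gid Z -> homog fs -> gle Z (gadds Z fs).
Proof.
move=> gZ; elim: fs => [|p fs IH] /=; first by move=> _ n a.
by move=> /homog_cons[p0 pp hfs]; apply: gle_trans (IH hfs) _; exact: gle_gadd.
Qed.

Lemma gadds_min Z X fs : gid Z -> homog fs -> gid X -> gle Z X ->
  (forall p, p \in fs -> X p.1 p.2) -> gle (gadds Z fs) X.
Proof.
move=> gZ hfs gX ZX; elim: fs hfs => //= p fs IH /homog_cons[p0 pp hfs] Xfs.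
apply: gadd_min => //; last by apply: Xfs; rewrite mem_head.
by apply: IH => // q qfs; apply: Xfs; rewrite inE qfs orbT.
Qed.

Lemma gadds_mem Z fs p : gid Z -> homog fs -> p \in fs -> gadds Z fs p.1 p.2.
Proof.
move=> gZ; elim: fs => //= q fs IH /homog_cons[q0 qq hfs].
have gA := gid_gadds gZ hfs.
rewrite inE => /predU1P[->|pfs]; first exact: gadd_gen.
by apply: gle_gadd; exact: IH.
Qed.

Lemma gdim_parameters Z D : gid Z -> (gdim Z <= D)%N ->
  exists fs, [/\ homog fs, size fs = D & gdim (gadds Z fs) = 0%N].
Proof.
elim: D Z => [|D IH] Z gZ dZ.
  by exists [::]; split=> //; apply/eqP; rewrite -leqn0.
(* The irrelevant ideal of G: m represents zero in degree 0, and all forms of positive degree are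
   included. *)
pose a n := pw (maxn 1 n).
have ga : gid a.
  split=> n; last by apply: pw_le; rewrite geq_max leqnSn.
  split; [exact: idl_pw | by apply: pw_le; exact: leq_maxr |].
  by move=> b z b1 zn; apply: (pw_le _ (pwM b1 zn)); lia.
have [||e [f [e0 af dA]]] := @gdim_avoid Z a D gZ ga _ dZ _.
- by [].
- rewrite (gdim_eq0 A_noetherian A_local ga) //; exists 1%N => n n1.
  by rewrite /a (maxn_idPr n1).
have fe := gid_sub ga af.
have [fs [hfs sfs dfs]] := IH _ (gid_gadd gZ fe) dA.
exists (rcons fs (e, f)); split.
- by move=> p; rewrite mem_rcons inE => /predU1P[->//|/hfs].
- by rewrite size_rcons sfs.
- by rewrite /gadds foldr_rcons.
Qed.

Definition gzero n : set A := pw n.+1.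

Lemma gid_gzero : gid gzero.
Proof.
split=> n //; split; [exact: idl_pw | exact: pw_le |].
by move=> a z a1 zn; exact: (pwM a1 zn).
Qed.

End HomogParams.
(** * Noether normalisation *)

Section Adjunction.
Variables (A : comNzRingType) (m : idealr A).
Hypotheses (A_noetherian : noetherian A) (A_local : is_local m).
Hypothesis pw_domain : forall i j a b, pw m i a -> pw m j b ->
  pw m (i + j).+1 (a * b) -> pw m i.+1 a \/ pw m j.+1 b.
Local Notation pw := (pw m).
Local Notation gid := (gid m).
Local Notation gadd := (gadd m).
Local Notation gadds := (gadds m).
Local Notation gdim := (gdim m).
Local Notation gprime := (gprime m).
Local Notation homog := (homog m).
Implicit Types V W R : nat -> set A.

Let idl_pw n : idl (pw n) := idl_pw m n.

(* Graded subspaces of [G] over the residue field. *)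
Definition gsub V := forall n, [/\ idl (V n), pw n.+1 `<=` V n & V n `<=` pw n].

Definition gact R V := forall i j r v, R i r -> V j v -> V (i + j)%N (r * v).

(* The graded subspace [V[f] = V + f V + f^2 V + ...], for [f] of degree [e]. *)
Inductive adj V (e : nat) (f : A) : nat -> A -> Prop :=
| adj0 n v : V n v -> adj V e f n v
| adjS n k v u : n = (k + e)%N -> V n v -> adj V e f k u -> adj V e f n (v + f * u).

Lemma adj_mul V e f n u : gsub V -> adj V e f n u -> adj V e f (n + e)%N (f * u).
Proof.
move=> sV nu; rewrite -[f * u]add0r; apply: adjS nu => //.
by apply: idl0; have [] := sV (n + e)%N.
Qed.

Lemma adjD V e f n u v : gsub V -> adj V e f n u -> adj V e f n v -> adj V e f n (u + v).
Proof.
move=> sV nu; have iV k : idl (V k) by have [] := sV k.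
elim: nu v => {n u} [n u Vu|n k u w nE Vu kw IH] v nv.
  case: nv Vu => {n v} [n v Vv|n k v w nE Vv kw] Vu.
    by apply: adj0; exact: idlD.
  by rewrite addrA; apply: adjS kw => //; exact: idlD.
case: nv nE Vu => {n v} [n v Vv|n k' v w' nE' Vv kw'] nE Vu.
  by rewrite addrAC; apply: adjS kw => //; exact: idlD.
have kk' : k = k' by apply: (@addIn e); rewrite -nE.
rewrite addrACA -mulrDr; apply: (adjS nE); first exact: idlD.
by apply: IH; rewrite kk'.
Qed.

Lemma gact_adjr R V e f : gsub V -> gact R V -> gact R (adj V e f).
Proof.
move=> sV RV i j r v Rr; elim=> {j v} [n v Vv|n k v u nE Vv ku IH].
  by apply: adj0; exact: RV.
rewrite mulrDr mulrCA; apply: (adjS _ _ IH); first by rewrite nE addnA.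
exact: RV.
Qed.

(** The residue field as a graded subspace of G: m^(n+1) represents zero in positive degree. *)
Definition gconst n : set A := if n is 0 then setT else pw n.+1.

Lemma gsub_const : gsub gconst.
Proof.
case=> [|n]; split=> //; [by move=> a _; exact: pw0 | exact: idl_pw | exact: pw_le].
Qed.

Lemma gact_const V : gsub V -> gact gconst V.
Proof.
move=> sV [|i] j r v; have [iV jV Vj] := sV j.
  by move=> _; exact: idlM.
move=> ri /Vj vj; have [_ + _] := sV (i.+1 + j)%N; apply.
exact: (pwM ri vj).
Qed.

Lemma gsub_adj V e f : pw e f -> gsub V -> gsub (adj V e f).
Proof.
move=> fe sV n; have [iV nV Vn] := sV n; split.
- split; first by apply: adj0; exact: idl0.
  move=> a u v nu nv; apply: adjD => //.
  by apply: (@gact_adjr gconst V e f sV (gact_const sV) 0%N n).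
- by move=> a an; apply: adj0; exact: nV.
- move=> u; elim=> {n iV nV Vn u} [n v|n k v u nE Vv _ uk]; first by have [_ _] := sV n; apply.
  apply: idlD => //; first by have [_ _] := sV n; apply.
  by rewrite nE addnC; exact: pwM.
Qed.

Lemma gact_adj R V e f : pw e f -> gsub V -> gact R V -> gact (adj R e f) (adj V e f).
Proof.
move=> fe sV RV i j r v; elim=> {i r} [n r Rr|n k r u nE Rr _ IH] Vv.
  exact: (gact_adjr sV RV).
rewrite mulrDl -mulrA; apply: adjD => //; first exact: (gact_adjr sV RV).
by rewrite nE addnAC; apply: adj_mul => //; exact: IH.
Qed.

(* The subalgebra of [G] generated over the residue field by [fs]. *)
Definition galg (fs : seq (nat * A)) := foldr (fun p V => adj V p.1 p.2) gconst fs.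

Lemma gsub_galg fs : homog fs -> gsub (galg fs).
Proof.
elim: fs => [_|p fs IH /homog_cons[p0 pp hfs]]; first exact: gsub_const.
by apply: gsub_adj => //; exact: IH.
Qed.

Lemma gact_galg fs : homog fs -> gact (galg fs) (galg fs).
Proof.
elim: fs => [_|p fs IH /homog_cons[p0 pp hfs]]; first exact: (gact_const gsub_const).
by apply: gact_adj => //; [exact: gsub_galg | exact: IH].
Qed.

Lemma galg_const fs a : galg fs 0%N a.
Proof. by elim: fs => //= p fs IH; apply: adj0. Qed.

Lemma galg_mem fs p : homog fs -> p \in fs -> galg fs p.1 p.2.
Proof.
elim: fs => //= q fs IH /homog_cons[q0 qq hfs]; rewrite inE => /predU1P[->|pfs].
  rewrite -[X in adj _ _ _ _ X]mulr1; apply: (@adj_mul _ _ _ 0%N); first exact: gsub_galg.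
  by apply: adj0; exact: galg_const.
by apply: adj0; exact: IH.
Qed.

Lemma gadds_gdim_ge Z fs : gid Z -> homog fs ->
  (gdim Z <= gdim (gadds Z fs) + size fs)%N.
Proof.
move=> gZ; elim: fs => /= [_|p fs IH /homog_cons[p0 pp hfs]]; first by rewrite addn0.
have := gdim_gadd_ge A_noetherian A_local (gid_gadds gZ hfs) pp p0.
by have := IH hfs; lia.
Qed.

(** If f were in p, the forms [fs] alone would bring the dimension to 0, but each form lowers it by
    at most one. *)
Lemma gadds_cons_notin p e f fs : gid p -> homog ((e, f) :: fs) ->
  (size fs < gdim p)%N -> gdim (gadds p ((e, f) :: fs)) = 0%N -> ~ p e f.
Proof.
move=> gp /homog_cons[/= e0 fe hfs] dp d0 pf; have gpfs := gid_gadds gp hfs.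
have : gdim (gadds p fs) = 0%N.
  rewrite -d0; apply/esym/(gdim_ext A_noetherian A_local gpfs (gid_gadd gpfs fe)).
    exact: gle_gadd.
  by apply: (gadd_min gpfs) => [? ?|]; last exact: (gle_gadds gp hfs pf).
by have := gadds_gdim_ge gp hfs; lia.
Qed.

Lemma gdim_gadds_above p q e f fs : gid p -> homog ((e, f) :: fs) -> gid q ->
  gle (gadd p e f) q -> gdim (gadds p ((e, f) :: fs)) = 0%N -> gdim (gadds q fs) = 0%N.
Proof.
move=> gp /homog_cons[/= e0 fe hfs] gq Aq d0.
apply/eqP; rewrite -leqn0 -d0; apply: gdim_le => //.
- by apply: gid_gadd => //; exact: gid_gadds.
- exact: gid_gadds.
apply: gadd_min; first exact: gid_gadds.
  apply: gadds_min => //; first exact: gid_gadds.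
    apply: gle_trans (gle_gadds gq hfs).
    by apply: gle_trans Aq; exact: gle_gadd.
  by move=> x xfs; exact: gadds_mem.
by apply: (gle_gadds gq hfs); apply: Aq; exact: gadd_gen.
Qed.

(** Write r = v + f u with v in the algebra of the remaining forms. Then v lies in p + (f), hence in
    a prime q above it of dimension at least [size fs], and v = 0 in G by induction. As f is not in
    p, u lies in p, and the inner induction applies. *)
Lemma galg_independent fs p : homog fs -> gprime p -> (size fs <= gdim p)%N ->
  gdim (gadds p fs) = 0%N -> forall n r, galg fs n r -> p n r -> pw n.+1 r.
Proof.
elim: fs p => [|[e f] fs IH] p.
  move=> _ pp _ _ [|n] r //= _ pr; apply: contrapT => /(pw_unit A_noetherian A_local)[b br].
  by have [gp p1 _] := pp; apply: p1; rewrite -br; apply: idlM => //; exact: (gid_idl _ gp).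
move=> hfs' pp dp d0; have [/= e0 fe hfs] := homog_cons hfs'.
have [gp p1 pM] := pp; have gA := gid_gadd gp fe.
have npf := gadds_cons_notin gp hfs' dp d0.
have H : forall n r, galg fs n r -> gadd p e f n r -> pw n.+1 r.
  (* [gprime_above] asks for a positive dimension. With no forms left, v is a constant, and a
     nonzero constant is a unit. *)
  have [s0|s0] := posnP (size fs).
    move=> n r; have -> : fs = [::] by apply/nilP; rewrite /nilp s0.
    case: n => // _; rewrite /gadd leqn0 (gtn_eqF e0) => pr.
    apply: contrapT => /(pw_unit A_noetherian A_local)[b br].
    by apply: p1; rewrite -br; apply: idlM => //; exact: (gid_idl _ gp).
  have [|q [pq Aq dq]] := @gprime_above _ m A_noetherian A_local _ (size fs) gA.
    rewrite s0 /=; have := gdim_gadd_ge A_noetherian A_local gp fe e0; move: dp => /=; lia.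
  have [gq q1 qM] := pq.
  move=> n r fr /Aq qr; apply: (IH q) => //.
  exact: gdim_gadds_above gp hfs' gq Aq d0.
move=> n r; elim=> {n r} [n v fv pv|n k v u nE fv ku IHu pvu].
  by apply: H => //; exact: gle_gadd.
have sV := gsub_galg hfs.
have uk : pw k u by have [_ _] := gsub_adj fe sV k; apply.
have fun_ : pw n.+1 v.
  apply: H => //; rewrite nE -[v](addrK (f * u)) -nE; apply: idlB.
  - exact: (gid_idl _ gA).
  - exact: gle_gadd.
  - by apply: gadd_mem => //; rewrite nE ?leq_addl // addnK.
have pfu : p n (f * u).
  rewrite -[_ * _](addKr v) addrC; apply: idlB => //; first exact: (gid_idl _ gp).
  exact: (gid_pw gp).
have pku : p k u by move: pfu; rewrite nE addnC => /pM[].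
apply: idlD => //; rewrite nE mulrC.
by rewrite -addSn; apply: pwM => //; exact: IHu.
Qed.

(* [f] is transcendental over [V]: the sum [V + f V + f^2 V + ...] is direct. *)
Definition gfree V e f := forall n v u, V (n + e)%N v -> adj V e f n u ->
  pw (n + e).+1 (v + f * u) -> pw (n + e).+1 v.

(* [R h], up to the factor [h] of degree [t]. *)
Definition gshift R t n : set A := if (t <= n)%N then R (n - t)%N else [set 0].

Lemma gshift_act R S t i n r v : (forall k, S k 0) -> gact R S ->
  R i r -> gshift S t n v -> gshift S t (i + n) (r * v).
Proof.
rewrite /gshift => S0 RS Ri; case: ifP => tn.
  by rewrite (leq_trans tn (leq_addl _ _)) -addnBA //; exact: RS.
by move=> ->; rewrite mulr0; case: ifP.
Qed.

Lemma idl_gshift R t n : gsub R -> idl (gshift R t n).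
Proof.
move=> sR; rewrite /gshift; case: ifP => _; first by have [] := sR (n - t)%N.
by split=> // a u v -> ->; rewrite mulr0 addr0.
Qed.

Lemma gshift_mul R t h n r : gsub R -> pw t h -> gshift R t n r -> pw n (r * h).
Proof.
rewrite /gshift => sR th; case: ifP => [tn Rr|_ ->]; last by rewrite mul0r; exact: idl0.
rewrite -[n](subnK tn); apply: pwM => //.
by have [_ _] := sR (n - t)%N; apply.
Qed.

Definition gspan_add R W t h n : set A :=
  [set z | exists r, gshift R t n r /\ W n (z - r * h)].

Lemma gsub_span_add R W t h : gsub R -> gsub W -> pw t h -> gsub (gspan_add R W t h).
Proof.
move=> sR sW th n; have [iW nW Wn] := sW n; have iR := idl_gshift t n sR; split.
- split; first by exists 0; rewrite mul0r subr0; split; exact: idl0.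
  move=> a u v [r [Rr Wu]] [r' [Rr' Wv]]; exists (a * r + r'); split.
    by case: iR => _; apply.
  rewrite (_ : _ - _ = a * (u - r * h) + (v - r' * h)); last by ring.
  by case: iW => _; apply.
- by move=> a an; exists 0; rewrite mul0r subr0; split; [exact: idl0 | exact: nW].
- move=> a [r [Rr /Wn Wa]]; apply: (idl_sub (idl_pw n) Wa).
  exact: gshift_mul Rr.
Qed.

Lemma gact_span_add R W t h : gsub R -> gact R R -> gact R W -> gact R (gspan_add R W t h).
Proof.
move=> sR RR RW i n r v Rr [r' [Rr' Wv]]; exists (r * r'); split.
  by apply: (gshift_act _ RR Rr Rr') => k; apply: idl0; have [] := sR k.
by rewrite -mulrA -mulrBr; exact: RW.
Qed.

Lemma adj_span_add R W t h e f n z : gsub R -> gsub W ->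
  adj (gspan_add R W t h) e f n z ->
  exists r, gshift (adj R e f) t n r /\ adj W e f n (z - r * h).
Proof.
move=> sR sW; elim=> {n z} [n v [r [Rr Wv]]|n k v u nE [r [Rr Wv]] _ [q [Rq Wu]]].
  exists r; split; last exact: adj0.
  by move: Rr; rewrite /gshift; case: ifP => // _ Rr; exact: adj0.
exists (r + f * q); split; last first.
  rewrite (_ : _ - _ = (v - r * h) + f * (u - q * h)); last by ring.
  exact: adjS Wu.
move: Rr Rq; rewrite /gshift; case: ifP => tn; last first.
  case: ifP => [tk|_ -> ->]; last by rewrite mulr0 addr0.
  by move: tn; rewrite nE (leq_trans tk) ?leq_addr.
move=> Rr; case: ifP => [tk Rq|_ ->]; last by rewrite mulr0 addr0; exact: adj0.
by apply: adjS Rq => //; rewrite nE addnBAC.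
Qed.

(* A list of elements of the graded domain is, up to a common multiplier [c] in the
   subalgebra [R[f]], contained in a module [W[f]] that is free over [f]: elements that
   can be added to [W] without destroying freeness are added, the others are torsion
   modulo [W[f]] and are multiplied into [W[f]]. *)
Lemma free_envelope R e f (hs : seq (nat * A)) : pw e f ->
  gsub R -> gact R R -> R 0%N 1 -> gfree R e f -> (forall p, p \in hs -> pw p.1 p.2) ->
  exists W t c, [/\ [/\ gsub W, gact R W & gfree W e f],
    adj R e f t c, ~ pw t.+1 c &
    forall p, p \in hs -> adj W e f (t + p.1)%N (c * p.2)].
Proof.
move=> fe sR RR R1 Rfree; have sRf := gsub_adj fe sR.
elim: hs => [_|[t h] hs IH hhs].
  exists (fun n => pw n.+1), 0%N, 1; split=> //.
  - split.
    + by move=> n; split=> //; exact: pw_le.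
    + move=> i j r v Rr vj; rewrite -addnS; apply: pwM => //.
      by have [_ _] := sR i; apply.
    + by [].
  - exact: adj0.
  - exact: (pw1_1 (m := m)).
have [|W [t0 [c [[sW RW Wfree] Rc nc ch]]]] := IH.
  by move=> p pin; apply: hhs; rewrite inE pin orbT.
have th : pw t h by exact: (hhs _ (mem_head _ _)).
pose W' := gspan_add R W t h.
have sW' : gsub W' by exact: gsub_span_add.
have RW' : gact R W' by exact: gact_span_add.
have WW' n z : adj W e f n z -> adj W' e f n z.
  have WW'0 k v : W k v -> W' k v.
    by exists 0; rewrite mul0r subr0; split=> //; apply: idl0; exact: idl_gshift.
  elim=> {n z} [n v Wv|n k v u nE Wv _ IHu]; first by apply: adj0; exact: WW'0.
  by apply: adjS IHu => //; exact: WW'0.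
have [W'free|] := pselect (gfree W' e f).
  exists W', t0, c; split=> // p; rewrite inE => /predU1P[->/=|pin]; last exact/WW'/ch.
  apply: (gact_adj fe sW' RW') => //; apply: adj0; exists 1; split.
    by rewrite /gshift leqnn subnn.
  by rewrite mul1r subrr; apply: idl0; have [] := sW t.
(* A relation v + f u = 0 in G with v nonzero shows that h is torsion modulo W[f]: the total
   coefficient r + f q of h in it multiplies h into W[f]. *)
move=> /existsNP[n /existsNP[v /existsNP[u /not_implyP[[r [Rr Wv]] /not_implyP[W'u /not_implyP[vu nv]]]]]].
have [q [Rq Wu]] := adj_span_add sR sW W'u.
have key : v - r * h + f * (u - q * h) = (v + f * u) - (r + f * q) * h by ring.
have [tn|nt] := leqP t (n + e)%N; last first.
  exfalso; apply: nv.
  have r0 : r = 0 by move: Rr; rewrite /gshift leqNgt nt.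
  have q0 : q = 0 by move: Rq; rewrite /gshift leqNgt (leq_ltn_trans (leq_addr _ _) nt).
  move: Wv Wu; rewrite r0 q0 mul0r !subr0 => Wv Wu.
  exact: Wfree Wu vu.
have Rr' : R (n + e - t)%N r by move: Rr; rewrite /gshift tn.
have Rc' : adj R e f (n + e - t)%N (r + f * q).
  move: Rq; rewrite /gshift; case: ifP => [tk Rq|_ ->].
    by apply: adjS Rq => //; rewrite addnBAC.
  by rewrite mulr0 addr0; exact: adj0.
(* If r + f q vanished, so would r by freeness of R[f]; the relation would then be one in W[f] and
   force v = 0. *)
have nc' : ~ pw (n + e - t).+1 (r + f * q).
  move=> c'0; apply: nv.
  have r0 : pw (n + e - t).+1 r.
    move: Rq c'0; rewrite /gshift; case: ifP => [tk Rq|_ ->]; last by rewrite mulr0 addr0.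
    move=> c'0; move: Rr' c'0; rewrite -addnBAC // => Rr' c'0; exact: Rfree Rq c'0.
  have up x : pw (n + e - t).+1 x -> pw (n + e).+1 (x * h).
    by move=> x0; rewrite -[in X in pw X _](subnK tn) -addSn; exact: pwM.
  rewrite -[v](subrK (r * h)); apply: idlD => //; last exact: up.
  apply: (Wfree _ _ _ Wv Wu); rewrite key; apply: idlB => //; exact: up.
exists W, (n + e - t + t0)%N, ((r + f * q) * c); split=> //.
- exact: (gact_adj fe sR RR).
- have [_ _ Rpw'] := sRf (n + e - t)%N; have [_ _ Rpw0] := sRf t0.
  by move=> /(pw_domain (Rpw' _ Rc') (Rpw0 _ Rc))[].
- move=> p; rewrite inE => /predU1P[->/=|pin]; last first.
    rewrite -mulrA -addnA; apply: (gact_adj fe sW RW) => //; exact: ch.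
  rewrite -mulrA mulrCA addnAC subnK // addnC; apply: (gact_adj fe sW RW) => //.
  have -> : (r + f * q) * h = (v + f * u) - (v - r * h + f * (u - q * h)) by rewrite key; ring.
  have [iWa nWa _] := gsub_adj fe sW (n + e)%N.
  apply: idlB => //; first exact: nWa.
  exact: adjS Wu.
Qed.

End Adjunction.
(** * Fractions with denominators in codimension two *)

Section Codimension.
Variables (A : comNzRingType) (m : idealr A).
Hypotheses (A_noetherian : noetherian A) (A_local : is_local m).
Hypothesis pw_domain : forall i j a b, pw m i a -> pw m j b ->
  pw m (i + j).+1 (a * b) -> pw m i.+1 a \/ pw m j.+1 b.
Local Notation pw := (pw m).
Local Notation gid := (gid m).
Local Notation gadd := (gadd m).
Local Notation gadds := (gadds m).
Local Notation gdim := (gdim m).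
Local Notation gprime := (gprime m).
Local Notation homog := (homog m).
Local Notation gzero := (gzero m).
Local Notation galg := (galg m).
Local Notation gsub := (gsub m).
Local Notation gfree := (gfree m).
Implicit Types V W R : nat -> set A.

Let idl_pw n : idl (pw n) := idl_pw m n.

Lemma pw_cancelX e f k n v : pw e f -> ~ pw e.+1 f -> pw n v ->
  pw (n + e * k).+1 (f ^+ k * v) -> pw n.+1 v.
Proof.
move=> fe nfe vn; elim: k => [|k IH]; first by rewrite muln0 addn0 mul1r.
rewrite mulnS addnCA exprS -mulrA => H; apply: IH.
have fkv : pw (n + e * k) (f ^+ k * v) by rewrite addnC; apply: pwM => //; exact: pwX.
by case: (pw_domain fe fkv H).
Qed.

(** Orders add up in a domain G, so m^l : f^k lies in m^(l - ek) for f of order e. *)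
Lemma pw_div e f k l z : pw e f -> ~ pw e.+1 f -> pw l (f ^+ k * z) -> pw (l - e * k) z.
Proof.
move=> fe nfe fz.
suff H j : (j <= l - e * k)%N -> pw j z by exact: H.
elim: j => [|j IH] jl; first exact: pw0.
apply: (pw_cancelX (k := k) fe nfe); first exact: IH (ltnW jl).
by apply: pw_le fz; lia.
Qed.

Lemma generators_below N : exists hs : seq (nat * A),
  (forall p, p \in hs -> pw p.1 p.2) /\
  forall n J, (n < N)%N -> idl J ->
    (forall p, p \in hs -> p.1 = n -> J p.2) -> pw n `<=` J.
Proof.
elim: N => [|N [hs [hspw hsgen]]]; first by exists [::].
have [s [sN smin]] := noetherian_gen A_noetherian (idl_pw N).
exists (hs ++ [seq (N, u) | u <- s]); split.
  by move=> p; rewrite mem_cat => /orP[/hspw//|/mapP[u us ->]]; exact: sN.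
move=> n J; rewrite ltnS leq_eqVlt => /predU1P[->|nN] iJ hJ.
  apply: smin => // u us; apply: (hJ (N, u)) => //.
  by rewrite mem_cat map_f // orbT.
by apply: hsgen => // p ps; apply: hJ; rewrite mem_cat ps.
Qed.

(** G modulo the parameters vanishes from some degree N on, so G is generated over their algebra by
    forms of degree below N. A multiplier for these finitely many forms works for all of G. *)
Lemma multiplier_into_free e f fs : homog ((e, f) :: fs) ->
  (size fs < gdim gzero)%N -> gdim (gadds gzero ((e, f) :: fs)) = 0%N ->
  exists W t c, [/\ gsub W, gact (galg fs) W, gfree W e f, pw t c /\ ~ pw t.+1 c &
    forall n a, pw n a -> adj W e f (t + n)%N (c * a)].
Proof.
move=> hfs' dz d0; have [/= e0 fe hfs] := homog_cons hfs'.
have gZ := gid_gzero m; have gA := gid_gadd gZ fe.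
have sR := gsub_galg hfs; have RR := gact_galg hfs.
(* A relation v + f u = 0 puts v into every prime containing f, and [fs] stays independent modulo
   one of dimension at least [size fs]. *)
have Rfree : gfree (galg fs) e f.
  move=> n v u Rv Ru vu; have [s0|s0] := posnP (size fs).
    move: Rv; have -> : fs = [::] by apply/nilP; rewrite /nilp s0.
    by rewrite /=; case: (n + e)%N (leq_trans e0 (leq_addl n e)).
  have [|p [pp Ap dp]] := @gprime_above _ m A_noetherian A_local _ (size fs) gA.
    by rewrite s0 /=; have := gdim_gadd_ge A_noetherian A_local gZ fe e0; lia.
  have [gp _ _] := pp.
  have dp0 := gdim_gadds_above A_noetherian A_local gZ hfs' gp Ap d0.
  apply: (galg_independent A_noetherian A_local hfs pp dp dp0 Rv).
  rewrite -[v](addrK (f * u)); apply: idlB; first exact: (gid_idl _ gp).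
    exact: (gid_pw gp).
  rewrite (mulrC f); apply: (gidM gp); last exact/Ap/(gadd_gen _ _ gZ).
  by have [_ _] := gsub_adj fe sR n; apply.
have [N NP] := gdim_eq0_full A_noetherian A_local (gid_gadds gZ hfs') d0.
have [hs [hspw hsgen]] := generators_below N.
have [W [t [c [[sW RW Wfree] Rc nc ch]]]] :=
  free_envelope pw_domain fe sR RR (galg_const _ _ _) Rfree hspw.
have tc : pw t c by have [_ _] := gsub_adj fe sR t; apply.
exists W, t, c; split=> // n.
have iF k : idl (adj W e f k) by have [] := gsub_adj fe sW k.
have [k] := ubnP n; elim: k n => // k IH n; rewrite ltnS => nk a an.
have [nN|Nn] := ltnP n N.
  apply: (hsgen n (colon (adj W e f (t + n)) c) nN) => //; first exact: idl_colon.
  by move=> p ps pn; rewrite /colon /= -pn; exact: ch.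
have gens p : p \in (e, f) :: fs -> (p.1 <= n)%N -> forall b, pw (n - p.1) b ->
    adj W e f (t + n)%N (c * (p.2 * b)).
  move=> pfs pn b bn; have [p0 pp] := hfs' p pfs.
  rewrite mulrCA -[in (t + n)%N](subnKC pn) addnCA; apply: (gact_adj fe sW RW).
    move: pfs; rewrite inE => /predU1P[->|pfs] /=; last by apply: adj0; exact: galg_mem.
    by rewrite -[X in adj _ _ _ _ X]mulr1; apply: (@adj_mul _ m _ _ _ 0%N) => //; apply: adj0; exact: galg_const.
  by apply: IH => //; lia.
move: (NP n Nn a an) gens; elim: ((e, f) :: fs) a {an} => [|p L IHL] a /=.
  move=> an _; have [_ + _] := gsub_adj fe sW (t + n)%N; apply.
  by rewrite -addnS; apply: pwM.
rewrite {1}/gadd; case: ifP => [pn [b bn Lab]|_ La] gens; last first.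
  by apply: IHL => // q qL; apply: gens; rewrite inE qL orbT.
rewrite -[a](subrK (p.2 * b)) mulrDr; apply: idlD => //.
  by apply: IHL => // q qL; apply: gens; rewrite inE qL orbT.
by apply: gens => //; rewrite mem_head.
Qed.

(* [f1 ^+ j, f2 ^+ M] is a regular sequence on [W[f1]]. *)
Lemma free_regular W e1 f1 e2 f2 : gsub W -> gfree W e1 f1 ->
  (forall n v, W n v -> W (n + e2)%N (f2 * v)) ->
  pw e1 f1 -> ~ pw e1.+1 f1 -> pw e2 f2 -> ~ pw e2.+1 f2 ->
  forall M j n n' u z, adj W e1 f1 n u -> adj W e1 f1 n' z ->
    (n + e2 * M = n' + e1 * j)%N ->
    pw (n + e2 * M).+1 (f2 ^+ M * u - f1 ^+ j * z) ->
    pw n.+1 u \/ exists n'' u', [/\ (n = n'' + e1 * j)%N, adj W e1 f1 n'' u' &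
                                  pw n.+1 (u - f1 ^+ j * u')].
Proof.
move=> sW Wfree Wf2 fe1 nfe1 fe2 nfe2 M j.
have Wf2X n v : W n v -> W (n + e2 * M)%N (f2 ^+ M * v).
  move=> Wv; elim: M => [|k IH]; first by rewrite muln0 addn0 mul1r.
  by rewrite mulnSr addnA exprS -mulrA; exact: Wf2.
have Ff2X n v : adj W e1 f1 n v -> adj W e1 f1 (n + e2 * M)%N (f2 ^+ M * v).
  elim=> {n v} [n v Wv|n k v u nE Wv _ IH]; first by apply: adj0; exact: Wf2X.
  rewrite mulrDr mulrCA; apply: adjS IH; first by rewrite nE addnAC.
  exact: Wf2X.
have pwF n v : adj W e1 f1 n v -> pw n v by have [_ _ h] := gsub_adj fe1 sW n; exact: h.
have pwW n v : W n v -> pw n v by have [_ _ h] := sW n; exact: h.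
elim: j => [|j IH] n n' u z Fu Fz nn' uz.
  by right; exists n, u; rewrite muln0 addn0 mul1r subrr; split=> //; exact: idl0.
have Fz' : adj W e1 f1 (n' + e1 * j)%N (f1 ^+ j * z).
  elim: j {IH nn' uz} => [|j IHj]; first by rewrite muln0 addn0 mul1r.
  by rewrite mulnSr addnA exprS -mulrA; exact: adj_mul.
have nE : (n + e2 * M = n' + e1 * j + e1)%N by rewrite nn' mulnSr addnA.
have iF k : idl (adj W e1 f1 k) by have [] := gsub_adj fe1 sW k.
(* Split off the part v of u in W. As f2^M v stays in W, freeness makes it vanish in G, hence v too,
   and one factor f1 cancels from the rest. *)
case: Fu nn' uz nE => {n u} [n v Wv|n k v u nE' Wv Fu] nn' uz nE.
  left; apply: (pw_cancelX (k := M) fe2 nfe2); first exact: pwW.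
  have W1 := Wf2X _ _ Wv; rewrite nE in W1 uz *.
  apply: (Wfree _ _ (- (f1 ^+ j * z)) W1); first exact: idlN.
  by rewrite mulrN mulrA -exprS.
have kE : (k + e2 * M = n' + e1 * j)%N by apply: (@addIn e1); rewrite -nE nE' addnAC.
have W1 := Wf2X _ _ Wv; rewrite nE in W1 uz.
have split_eq : f2 ^+ M * (v + f1 * u) - f1 ^+ j.+1 * z =
    f2 ^+ M * v + f1 * (f2 ^+ M * u - f1 ^+ j * z) by rewrite exprS; ring.
have Fdiff : adj W e1 f1 (n' + e1 * j)%N (f2 ^+ M * u - f1 ^+ j * z).
  by apply: idlB => //; rewrite -kE; exact: Ff2X.
rewrite split_eq in uz.
have v0 := Wfree _ _ _ W1 Fdiff uz.
have vn : pw n.+1 v.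
  by apply: (pw_cancelX (k := M) fe2 nfe2); [exact: pwW | rewrite nE].
have d0 : pw (k + e2 * M).+1 (f2 ^+ M * u - f1 ^+ j * z).
  apply: (pw_cancelX (e := e1) (f := f1) (k := 1) fe1 nfe1).
    by rewrite kE; exact: pwF.
  rewrite expr1 muln1 kE -[_ * _](addKr (f2 ^+ M * v)) addrC; exact: idlB.
case: (IH k n' u z Fu Fz kE d0) => [uk|[n'' [u' [kE' Fu' uu']]]].
  left; apply: idlD => //; rewrite nE' addnC -addnS; exact: pwM.
right; exists n'', u'; split=> //; first by rewrite nE' kE' mulnSr addnA.
rewrite exprS -mulrA -addrA -mulrBr; apply: idlD => //.
by rewrite nE' addnC -addnS; exact: pwM.
Qed.

Section Fractions.
Variables (W : nat -> set A) (t e1 e2 s : nat) (c f1 f2 x : A).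
Hypotheses (sW : gsub W) (Wfree : gfree W e1 f1)
  (Wf2 : forall n v, W n v -> W (n + e2)%N (f2 * v))
  (e1_gt0 : (0 < e1)%N) (e2_gt0 : (0 < e2)%N)
  (fe1 : pw e1 f1) (nfe1 : ~ pw e1.+1 f1) (fe2 : pw e2 f2) (nfe2 : ~ pw e2.+1 f2)
  (ct : pw t c) (nct : ~ pw t.+1 c) (xs : pw s x) (nxs : ~ pw s.+1 x)
  (cF : forall n a, pw n a -> adj W e1 f1 (t + n)%N (c * a)).

(* [B \in fracs i] stands for the fraction [B / x ^+ i], with denominator supported in
   the codimension two locus [f1 = f2 = 0]. *)
Definition fracs i : set A := [set B | exists M z1 z2,
  f1 ^+ M * B = x ^+ i * z1 /\ f2 ^+ M * B = x ^+ i * z2].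

Lemma fracs_raise i B N : fracs i B -> exists M z1 z2, [/\ (N <= M)%N,
  f1 ^+ M * B = x ^+ i * z1 & f2 ^+ M * B = x ^+ i * z2].
Proof.
move=> [M [z1 [z2 [E1 E2]]]]; exists (N + M)%N, (f1 ^+ N * z1), (f2 ^+ N * z2).
by rewrite leq_addr !exprD -!mulrA E1 E2; split=> //; exact: mulrCA.
Qed.

Lemma idl_fracs i : idl (fracs i).
Proof.
split; first by exists 0%N, 0, 0; rewrite !mulr0.
move=> a u v Fu Fv; have [M [z1 [z2 [E1 E2]]]] := Fu.
have [M' [y1 [y2 [MM E1' E2']]]] := fracs_raise M Fv.
exists M', (a * (f1 ^+ (M' - M) * z1) + y1), (a * (f2 ^+ (M' - M) * z2) + y2).
split; rewrite !mulrDr ?E1' ?E2' -[in LHS](subnK MM) exprD; congr (_ + _).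
  rewrite (_ : _ * _ = a * (f1 ^+ (M' - M) * (f1 ^+ M * u))); last by ring.
  by rewrite E1; ring.
rewrite (_ : _ * _ = a * (f2 ^+ (M' - M) * (f2 ^+ M * u))); last by ring.
by rewrite E2; ring.
Qed.

Lemma fracsS i B : fracs i B -> fracs i.+1 (x * B).
Proof.
by move=> [M [z1 [z2 [E1 E2]]]]; exists M, z1, z2; rewrite !exprS -!mulrA -E1 -E2; split; ring.
Qed.

(** From f1^M B = x^i z1 and f2^M B = x^i z2 follows f2^M (c z1) = f1^M (c z2). Regularity on W[f1]
    divides the leading form of c z1 by f1^M, and the quotient g is the leading form of c B /
    x^i. *)
Lemma fracs_approx i q B : fracs i B -> pw q B -> pw q.+1 B \/
  exists n g, [/\ (n + s * i = q + t)%N, pw n g & pw (q + t).+1 (c * B - x ^+ i * g)].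
Proof.
move=> FB Bq; have [M [z1 [z2 [MM E1 E2]]]] := fracs_raise (s * i) FB.
(* Choosing M >= s i, with e1 and e2 positive, keeps the degrees of z1 and z2 from being
   truncated. *)
have le1 : (s * i <= q + e1 * M)%N by nia.
have le2 : (s * i <= q + e2 * M)%N by nia.
have z1n : pw (q + e1 * M - s * i) z1.
  by apply: (pw_div xs nxs); rewrite -E1 addnC; apply: pwM => //; exact: pwX.
have z2n : pw (q + e2 * M - s * i) z2.
  by apply: (pw_div xs nxs); rewrite -E2 addnC; apply: pwM => //; exact: pwX.
have cross : pw (t + (q + e1 * M - s * i) + e2 * M).+1 (f2 ^+ M * (c * z1) - f1 ^+ M * (c * z2)).
  rewrite -[X in pw X](addnK (s * i)); apply: (pw_div xs nxs).
  rewrite (_ : _ * _ = c * (f2 ^+ M * (x ^+ i * z1) - f1 ^+ M * (x ^+ i * z2))); last by ring.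
  rewrite -E1 -E2 (_ : _ * _ = 0); last by ring.
  exact: idl0.
have degE : (t + (q + e1 * M - s * i) + e2 * M = t + (q + e2 * M - s * i) + e1 * M)%N by lia.
have [u0|[n [u' [nE Fu' uu']]]] := free_regular sW Wfree Wf2 fe1 nfe1 fe2 nfe2
    (cF z1n) (cF z2n) degE cross.
  left; apply: (pw_cancelX (k := M) fe1 nfe1 Bq); rewrite E1.
  have z1' : pw (q + e1 * M - s * i).+1 z1.
    by apply: (pw_cancelX (k := 1) ct nct z1n); rewrite muln1 expr1 addnC.
  by rewrite -(subnKC le1) -addnS; apply: pwM => //; exact: pwX.
have u'n : pw n u' by have [_ _] := gsub_adj fe1 sW n; apply.
have nE' : (n + s * i = q + t)%N by lia.
right; exists n, u'; split=> //.
apply: (pw_cancelX (k := M) fe1 nfe1).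
  apply: idlB => //; first by rewrite addnC; exact: pwM.
  by rewrite -nE' addnC; apply: pwM => //; exact: pwX.
rewrite (_ : _ * _ = c * (f1 ^+ M * B) - x ^+ i * (f1 ^+ M * u')); last by ring.
rewrite E1 (_ : _ - _ = x ^+ i * (c * z1 - f1 ^+ M * u')); last by ring.
have := pwM (pwX i xs) uu'; congr (pw _ _).
lia.
Qed.

(* The leading forms of [c * B / x ^+ i], for [B] in [fracs i]; the chain of these graded
   ideals is stationary, which bounds the degree of the integral equation of [y / x]. *)
Definition lead_fracs i n : set A :=
  [set g | pw n g /\ exists2 B, fracs i B & pw (n + s * i).+1 (x ^+ i * g - c * B)].

Lemma gid_lead_fracs i : gid (lead_fracs i).
Proof.
have xi := pwX i xs.
split=> n; last first.
  move=> g gn; split; first exact: pw_le gn.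
  exists 0; first exact: (idl0 (idl_fracs i)).
  by rewrite mulr0 subr0 addnC -addnS; exact: pwM.
split.
- split; first split; first exact: idl0.
    exists 0; first exact: (idl0 (idl_fracs i)).
    by rewrite !mulr0 subrr; exact: idl0.
  move=> a u v [un [B FB uB]] [vn [D FD vD]]; split; first by case: (idl_pw n) => _; apply.
  exists (a * B + D); first by case: (idl_fracs i) => _; apply.
  rewrite (_ : _ - _ = a * (x ^+ i * u - c * B) + (x ^+ i * v - c * D)); last by ring.
  by case: (idl_pw (n + s * i).+1) => _; apply.
- by move=> g [].
- move=> a g a1 [gn [B FB gB]]; split; first exact: (pwM a1 gn).
  exists (a * B); first exact: (idlM _ (idl_fracs i)).
  rewrite (_ : _ - _ = a * (x ^+ i * g - c * B)); last by ring.
  by have := pwM a1 gB; congr (pw _ _); lia.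
Qed.

Lemma lead_fracsS i : gle (lead_fracs i) (lead_fracs i.+1).
Proof.
move=> n g [gn [B FB gB]]; split=> //; exists (x * B); first exact: fracsS.
rewrite (_ : _ - _ = x * (x ^+ i * g - c * B)); last by rewrite exprS; ring.
by have := pwM xs gB; congr (pw _ _); rewrite mulnS; lia.
Qed.

(** Where the chain of leading forms stops, the leading form of c B / x^(i+1) is that of some c B2 /
    x^i, and passing from B to B - x B2 raises the order. So B lies in (x) + m^q for all q, hence in
    (x). *)
Lemma fracs_integral : exists i, forall B, fracs i.+1 B -> exists b, B = x * b.
Proof.
have [i stab] := gid_stops A_noetherian gid_lead_fracs lead_fracsS.
exists i => B FB.
have approx q : exists2 B0, fracs i B0 & pw q (B - x * B0).
  elim: q => [|q [B0 FB0 Bq]]; first by exists 0; [exact: (idl0 (idl_fracs i)) | exact: pw0].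
  have FB1 : fracs i.+1 (B - x * B0) by apply: (idlB (idl_fracs _)) => //; exact: fracsS.
  case: (fracs_approx FB1 Bq) => [|[n [g [nE gn cg]]]]; first by exists B0.
  have : lead_fracs i.+1 n g.
    split=> //; exists (B - x * B0) => //; rewrite nE; exact: idlBC.
  move=> /stab[_ [B2 FB2 gB2]].
  exists (B0 + B2); first exact: (idlD (idl_fracs i)).
  rewrite (_ : _ - _ = (B - x * B0) - x * B2); last by ring.
  have : pw (q.+1 + t) (c ^+ 1 * (B - x * B0 - x * B2)).
    rewrite (_ : _ * _ = (c * (B - x * B0) - x ^+ i.+1 * g) + x * (x ^+ i * g - c * B2)); last first.
      by rewrite expr1 exprS; ring.
    apply: idlD => //.
    by have := pwM xs gB2; congr (pw _ _); rewrite mulnS in nE; lia.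
  by move=> /(pw_div ct nct); rewrite muln1 addnK.
apply: (krull_closure A_noetherian A_local (J := [set B | exists b, B = x * b])).
  split; first by exists 0; rewrite mulr0.
  by move=> a _ _ [u ->] [v ->]; exists (a * u + v); ring.
by move=> q; have [B0 _ Bq] := approx q; exists (x * B0) => //; exists B0.
Qed.

End Fractions.
End Codimension.
(** The domain hypothesis is applied to the classes of a 'X^i and b 'X^j; everything else uses it in
    this form. *)
Lemma assoc_graded_pw_domain (A : comNzRingType) (m : idealr A) :
  GRing.integral_domain_axiom (assoc_graded m) ->
  forall i j a b, pw m i a -> pw m j b -> pw m (i + j).+1 (a * b) ->
    pw m i.+1 a \/ pw m j.+1 b.
Proof.
move=> dom.
have form i a : pw m i a -> exists p : rees_ring m, val p = a *: 'X^i.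
  move=> ai; have ap : a *: 'X^i \in rees m.
    apply/asboolP => n; rewrite coefZ coefXn; case: eqP => [->|_]; first by rewrite mulr1.
    by rewrite mulr0; exact: (idl0 (idl_pw m n)).
  by exists (ReesRing ap).
have lead i a (p : rees_ring m) : val p = a *: 'X^i ->
    (\pi_(assoc_graded m) p = 0)%qT <-> pw m i.+1 a.
  move=> pE; rewrite assoc_graded_pi_eq0 pE; split=> [/(_ i)|ai n].
    by rewrite coefZ coefXn eqxx mulr1.
  rewrite coefZ coefXn; case: eqP => [->|_]; first by rewrite mulr1.
  by rewrite mulr0; exact: (idl0 (idl_pw m n.+1)).
move=> i j a b /form[p pE] /form[q qE] abij.
have pqE : val (p * q) = (a * b) *: 'X^(i + j).
  by rewrite rmorphM /= pE qE -scalerAl -scalerAr scalerA exprD.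
have /dom : (\pi_(assoc_graded m) p * \pi_(assoc_graded m) q = 0)%qT.
  by rewrite -rmorphM; apply/(lead _ _ _ pqE).
by case/orP=> /eqP; [move/(lead _ _ _ pE); left | move/(lead _ _ _ qE); right].
Qed.

(** * Hilbert-Samuel polynomials of ideals *)

Section IdealDimension.
Variables (A : comNzRingType) (m : idealr A).
Hypotheses (A_noetherian : noetherian A) (A_local : is_local m).
Local Notation pw := (pw m).
Local Notation Len := (Len (pw 1)).
Local Notation addpw := (addpw m).
Implicit Types I J P : set A.

Let idl_pw n : idl (pw n) := idl_pw m n.
Let pw_unit := pw_unit A_noetherian A_local.

(* The ideal of leading forms of elements of [I]. *)
Definition ginit I n : set A := pw n `&` addpw I n.+1.

Lemma gid_ginit I : idl I -> gid m (ginit I).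
Proof.
move=> iI; split=> n; last first.
  by move=> a an; split; [exact: pw_le an | exact: addpwr].
split.
- by apply: idlI => //; exact: idl_addpw.
- by move=> a [].
- move=> a z a1 [zn [p Ip zp]]; split; first exact: (pwM a1 zn).
  exists (a * p); first exact: idlM.
  by rewrite -mulrBr; exact: (pwM a1 zp).
Qed.

Definition Lf I n := ell (pw 1) (addpw I n) setT.

(** (I + m^n)/(I + m^(n+1)) is the component of degree n of G modulo the leading forms of I. *)
Lemma Len_ginit I n : idl I -> Len (addpw I n.+1) (addpw I n) (hf m (ginit I) n).
Proof.
move=> iI; have gI := gid_ginit iI.
apply: (Len_iso (hfP A_noetherian A_local n gI)) => //; first exact: idl_addpw.
apply/seteqP; split=> z.
  move=> [p Ip zp]; exists (z - p) => //; exists p => //.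
  by rewrite (_ : z - _ - p = 0); [exact: idl0 | ring].
move=> [a an [p Ip zap]]; exists p => //.
rewrite (_ : z - p = (z - 1 * a - p) + a); last by ring.
by apply: idlD => //; exact: pw_le zap.
Qed.

Lemma LfP I n : idl I -> Len (addpw I n) setT (Lf I n).
Proof.
move=> iI; suff [k L] : exists k, Len (addpw I n) setT k.
  by rewrite /Lf (ellE pw_unit L) //; exact: idl_addpw.
elim: n => [|n [k L]].
  exists 0%N; have -> : addpw I 0 = setT; last exact: Len0.
  by apply/seteqP; split=> // a _; apply: addpwr => //; exact: pw0.
by exists (hf m (ginit I) n + k)%N; apply: Len_cat L; exact: Len_ginit.
Qed.

Lemma LfS I n : idl I -> Lf I n.+1 = (Lf I n + hf m (ginit I) n)%N.
Proof.
move=> iI; rewrite addnC.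
apply: (ellE pw_unit (Len_cat (Len_ginit n iI) (LfP n iI))); exact: idl_addpw.
Qed.

Lemma addpw_le I J n k : I `<=` J -> (k <= n)%N -> addpw I n `<=` addpw J k.
Proof. by move=> IJ kn a [p /IJ Jp ap]; exists p => //; exact: pw_le ap. Qed.

Lemma Lf_le I J n : idl I -> idl J -> I `<=` J -> (Lf J n <= Lf I n)%N.
Proof.
move=> iI iJ IJ; apply: (Len_le pw_unit (LfP n iJ) (LfP n iI)) => //; try exact: idl_addpw.
exact: addpw_le.
Qed.

Lemma Lf_ev_poly I : idl I -> exists p, ev_poly (Lf I) p /\
  back_diff 1 p = gpoly m (ginit I) \Po ('X - 1%:R%:P).
Proof.
move=> iI; apply: (ev_poly_integrate
  (ev_poly_shift 1 (gpolyP A_noetherian A_local (gid_ginit iI)))).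
by move=> n; rewrite LfS // subn1.
Qed.

Definition apoly I : {poly rat} := xget 0 [set p | ev_poly (Lf I) p].

Lemma apolyP I : idl I -> ev_poly (Lf I) (apoly I).
Proof.
move=> /Lf_ev_poly[q [qP _]]; rewrite /apoly.
by case: xgetP => [p _ //|/(_ q)].
Qed.

(* [adim I] is [dim (A / I) + 1] for proper [I], and [0] for [I = A]. *)
Definition adim I := size (apoly I).

Lemma adim_ginit I : idl I -> gdim m (ginit I) = (adim I).-1.
Proof.
move=> iI; have [p [pP pE]] := Lf_ev_poly iI.
rewrite /adim (ev_poly_uniq (apolyP iI) pP) -(size_back_diff p (oner_neq0 rat)) pE.
by rewrite size_comp_shift.
Qed.

Lemma adim_le I J : idl I -> idl J -> I `<=` J -> (adim J <= adim I)%N.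
Proof.
move=> iI iJ IJ; apply: (ev_poly_le (apolyP iJ) (apolyP iI)).
by exists 0%N => n _; exact: Lf_le.
Qed.

Lemma adim_gt0 I : idl I -> ~ I 1 -> I `<=` pw 1 -> (0 < adim I)%N.
Proof.
move=> iI I1 Im; rewrite lt0n size_poly_eq0; apply/eqP => p0.
have [N NP] := apolyP iI; have := NP (maxn N 1) (leq_maxl _ _).
rewrite p0 horner0 => /eqP; rewrite pnatr_eq0 => /eqP L0.
have := Len_pos (LfP (maxn N 1) iI); rewrite L0 => H.
have /H // : ~ (setT `<=` addpw I (maxn N 1)).
move=> /(_ 1 Logic.I) [p /Im p1 /(pw_le (leq_maxr _ _)) q1].
exact: (pw1_1 (idl_sub (idl_pw 1) q1 p1)).
Qed.

(** Here k is the length of A/((I + m^n) : a). The estimates that use it differ in the ideal with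
    which they compare this colon: (I : a) + m^n, I + m^(n-1) or I + m^(n-c). *)
Lemma Len_colon I n a : idl I -> exists2 k, Len (colon (addpw I n) a) setT k &
  Lf I n = (k + Lf (addmul a setT I) n)%N.
Proof.
move=> iI; have iIn := idl_addpw m n iI; have iC := idl_colon a iIn.
have iIa : idl (addmul a setT I) by apply: idl_addmul => //; exact: idlT.
have [|//|_ [k [_ L _]]] := Len_split pw_unit (LfP n iI) iIn iC.
  by move=> z Iz; rewrite /colon /=; exact: idlM.
exists k => //; apply: (ellE pw_unit) => //.
apply: (Len_cat _ (LfP n iIa)).
have := Len_map (f := a) L iC iIn (fun _ _ => iff_refl _).
have -> // : addmul a setT (addpw I n) = addpw (addmul a setT I) n.
apply/seteqP; split=> z.
  move=> [b _ [p Ip zp]]; exists (p + a * b).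
    by exists b => //; rewrite addrK.
  by rewrite (_ : z - _ = z - a * b - p) //; ring.
move=> [p [b _ Ipb] zp]; exists b => //; exists (p - a * b) => //.
by rewrite (_ : _ - (p - _) = z - p) //; ring.
Qed.

Lemma adim_add_colon I a : idl I ->
  (adim I <= maxn (adim (colon I a)) (adim (addmul a setT I)))%N.
Proof.
move=> iI; have iIa : idl (addmul a setT I) by apply: idl_addmul => //; exact: idlT.
have iC := idl_colon a iI.
apply: (leq_trans (ev_poly_le (apolyP iI) (ev_polyD (apolyP iC) (apolyP iIa)) _)); last first.
  exact: size_polyD.
exists 0%N => n _; have [k L ->] := Len_colon n a iI; rewrite leq_add2r.
apply: (Len_le pw_unit L (LfP n iC)) => //; first exact: idl_colon (idl_addpw m n iI).
  exact: idl_addpw.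
move=> z [p Cp zp]; exists (a * p) => //; rewrite -mulrBr; exact: idlM.
Qed.

Lemma adim_add_ge I a : idl I -> pw 1 a -> ((adim I).-1 <= adim (addmul a setT I))%N.
Proof.
move=> iI a1; have iIa : idl (addmul a setT I) by apply: idl_addmul => //; exact: idlT.
apply: (@size_back_diff_ge0 _ _ 1%:R) => //; first exact: ev_poly_ge0 (apolyP iI).
have [N NP] := ev_poly_back 1 (apolyP iI); have [M MP] := apolyP iIa.
exists (maxn 1 (maxn N M)) => n; rewrite !geq_max => /and3P[n1 /NP E1 /MP E2].
rewrite hornerD hornerN -E1 -E2; have [k L ->] := Len_colon n a iI.
have : (k <= Lf I (n - 1))%N.
  apply: (Len_le pw_unit L (LfP _ iI)) => //; first exact: idl_colon (idl_addpw m n iI).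
    exact: idl_addpw.
  move=> z [p Ip zp]; exists (a * p); first exact: idlM.
  by rewrite -mulrBr -[n in pw n](subnKC n1); exact: pwM.
by rewrite natrD -(ler_nat rat); lra.
Qed.

Lemma adim_regular I a : idl I -> (forall b, I (a * b) -> I b) ->
  (adim (addmul a setT I) <= (adim I).-1)%N.
Proof.
move=> iI Ia; have iIa : idl (addmul a setT I) by apply: idl_addmul => //; exact: idlT.
have [c cP] := colon_addpw m A_noetherian iI Ia.
apply: leq_trans (size_back_diff_le c%:R (apoly I)).
apply: eventually_ge0_size; first exact: ev_poly_ge0 (apolyP iIa).
have [N NP] := ev_poly_back c (apolyP iI); have [M MP] := apolyP iIa.
exists (maxn c (maxn N M)) => n; rewrite !geq_max => /and3P[nc /NP E1 /MP E2].
rewrite hornerD hornerN -E1 -E2; have [k L ->] := Len_colon n a iI.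
have : (Lf I (n - c) <= k)%N.
  apply: (Len_le pw_unit (LfP _ iI) L) => //; first exact: idl_addpw.
    exact: idl_colon (idl_addpw m n iI).
  by move=> z; rewrite /colon /= -{1}[n](subnK nc) => /cP.
by rewrite natrD -(ler_nat rat); lra.
Qed.

Lemma adim_setT : adim setT = 0%N.
Proof.
apply/eqP; rewrite size_poly_eq0; apply/eqP/(ev_poly_uniq (apolyP (@idlT A))).
exists 0%N => n _; rewrite horner0 /Lf (_ : addpw setT n = setT).
  by rewrite (ellE pw_unit (Len0 _ _)) //; exact: idlT.
by apply/seteqP; split=> // a _; exact: addpwl.
Qed.

Definition primeI P := [/\ idl P, ~ P 1 & forall a b, P (a * b) -> P a \/ P b].

Lemma primeI_max P : primeI P -> P `<=` pw 1.
Proof.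
move=> [iP P1 _] a Pa; apply: contrapT => /pw_unit[b ba].
by apply: P1; rewrite -ba; exact: idlM.
Qed.

Lemma prime_above I t : idl I -> (0 < t <= adim I)%N ->
  exists P, [/\ primeI P, I `<=` P & (t <= adim P)%N].
Proof.
move=> iI /andP[t0 tI].
have [||P [[iP IP tP] Pmax]] := chain_stops_max
    (S := fun P => [/\ idl P, I `<=` P & (t <= adim P)%N]) (x0 := I)
    (acc_stops (noetherian_acc A_noetherian)).
- by move=> ? [].
- by split.
exists P; split=> //; split=> //.
  move=> P1; have PT : P = setT.
    by apply/seteqP; split=> // a _; rewrite -[a]mulr1; exact: idlM.
  by move: tP; rewrite PT adim_setT leqNgt t0.
move=> a b Pab; apply: contrapT => /not_orP[nPa nPb].
have iPa : idl (addmul a setT P) by apply: idl_addmul => //; exact: idlT.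
have iC := idl_colon a iP.
have big J : idl J -> P `<=` J -> (exists2 c, J c & ~ P c) -> (adim J < t)%N.
  move=> iJ PJ [c Jc nPc]; rewrite ltnNge; apply/negP => tJ; apply: nPc.
  by apply: (Pmax J) => //; split=> //; exact: subset_trans PJ.
have dC : (adim (colon P a) < t)%N.
  by apply: big => //; [move=> z Pz; exact: idlM | exists b].
have dA : (adim (addmul a setT P) < t)%N.
  apply: big => //; first by move=> z; exact: addmulr.
  by exists a => //; rewrite -[X in addmul _ _ _ X]mulr1; exact: addmull.
have := leq_trans tP (adim_add_colon a iP).
by rewrite leqNgt gtn_max dC dA.
Qed.

Lemma adim_prime_lt P J : primeI P -> idl J -> P `<` J -> (adim J <= (adim P).-1)%N.
Proof.
move=> [iP P1 pP] iJ [PJ nJP].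
have [a Ja nPa] : exists2 a, J a & ~ P a.
  by apply: contrapT => H; apply: nJP => a Ja; apply: contrapT => nPa; apply: H; exists a.
have iPa : idl (addmul a setT P) by apply: idl_addmul => //; exact: idlT.
apply: leq_trans (adim_le iPa iJ _) (adim_regular iP _).
  by move=> z [b _ /PJ Jzb]; apply: (idl_sub iJ Jzb); rewrite mulrC; exact: idlM.
by move=> b /pP[].
Qed.

Lemma prime_chain_adim k (c : nat -> set A) : (forall i, (i <= k)%N -> primeI (c i)) ->
  (forall i, (i < k)%N -> c i `<` c i.+1) -> (k < adim (c 0%N))%N.
Proof.
elim: k c => [|k IH] c cp cS.
  have [ic c1 _] := cp 0%N (leqnn _).
  by apply: adim_gt0 => //; apply: primeI_max; exact: cp.
have := IH (fun i => c i.+1) (fun i ik => cp i.+1 ik) (fun i ik => cS i.+1 ik).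
have [i1 _ _] := cp 1%N isT.
have := adim_prime_lt (cp 0%N isT) i1 (cS 0%N isT); lia.
Qed.

(** Adding an element of m outside P lowers [adim] by at most one, and a prime of large enough
    [adim] above the sum continues the chain. *)
Lemma prime_chain_from P t : primeI P -> (t < adim P)%N -> exists c : nat -> set A,
  [/\ c 0%N = P, forall i, (i <= t)%N -> primeI (c i) & forall i, (i < t)%N -> c i `<` c i.+1].
Proof.
elim: t P => [|t IH] P pP tP; first by exists (fun=> P).
have [iP P1 pM] := pP.
have [a a1 nPa] : exists2 a, pw 1 a & ~ P a.
  apply: contrapT => H; have mP : pw 1 `<=` P.
    by move=> a a1; apply: contrapT => nPa; apply: H; exists a.
  have : gdim m (ginit P) = 0%N.
    apply: (gdim_eq0 A_noetherian A_local (gid_ginit iP)); exists 1%N => n n1 a an.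
    by split=> //; apply: addpwl; apply: mP; exact: pw_le an.
  by rewrite adim_ginit //; lia.
have iPa : idl (addmul a setT P) by apply: idl_addmul => //; exact: idlT.
have [|Q [pQ PQ tQ]] := prime_above (t := t.+1) iPa.
  by have := adim_add_ge iP a1; lia.
have [c [c0 cp cS]] := IH Q pQ tQ.
exists (fun i => if i is j.+1 then c j else P); split=> //; first by case.
case=> [_|i]; last exact: cS.
rewrite c0; split; first by move=> z Pz; apply: PQ; exact: addmulr.
move=> QP; apply: nPa; apply: QP; apply: PQ.
by rewrite -[X in addmul _ _ _ X]mulr1; exact: addmull.
Qed.

Lemma adim_krull_dim d : primeI [set 0] -> has_krull_dim A d -> adim [set 0] = d.+1.
Proof.
move=> p0 [[c [cp cS]] dmax].
have cp' i : (i <= d)%N -> primeI (c i) by move=> /cp /is_primeP.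
apply/eqP; rewrite eqn_leq; apply/andP; split.
  have [//|nd] := leqP (adim [set 0]) d.+1.
  have [c' [_ c'p c'S]] := prime_chain_from p0 nd.
  have := dmax d.+1 c'; rewrite ltnn; apply; split=> // i id.
  by apply/is_primeP; exact: c'p.
apply: leq_trans (prime_chain_adim cp' cS) _.
have [ic _ _] := cp' 0%N isT; have [i0 _ _] := p0.
by apply: adim_le => // z ->; exact: idl0.
Qed.

End IdealDimension.
(** * Primes of height one *)

Section HeightOne.
Variables (A : comNzRingType) (m : idealr A).
Hypotheses (A_noetherian : noetherian A) (A_local : is_local m).
Hypothesis pw_domain : forall i j a b, pw m i a -> pw m j b ->
  pw m (i + j).+1 (a * b) -> pw m i.+1 a \/ pw m j.+1 b.
Local Notation pw := (pw m).
Local Notation gid := (gid m).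
Local Notation gdim := (gdim m).
Local Notation gadd := (gadd m).
Local Notation gadds := (gadds m).
Local Notation gzero := (gzero m).
Local Notation adim := (adim m).
Local Notation ginit := (ginit m).
Local Notation Lf := (Lf m).
Implicit Types I J P : set A.

Let idl_pw n : idl (pw n) := idl_pw m n.

Lemma idl_set0 : idl [set 0 : A].
Proof. by split=> // a u v -> ->; rewrite mulr0 addr0. Qed.

Lemma pw_order a : a <> 0 -> exists i, pw i a /\ ~ pw i.+1 a.
Proof.
move=> a0; apply: contrapT => H; apply: a0.
apply: (krull_closure A_noetherian A_local idl_set0) => n; exists 0 => //; rewrite subr0.
elim: n => [|n IH]; first exact: pw0.
by apply: contrapT => nS; apply: H; exists n.
Qed.

Lemma primeI_set0 : primeI [set 0 : A].
Proof.
split; [exact: idl_set0 | by apply/eqP; exact: oner_neq0 |].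
move=> a b /= ab0; apply: contrapT => /not_orP[/pw_order[i [ai nai]] /pw_order[j [bj nbj]]].
have := pw_domain ai bj; rewrite ab0 => -[] //; exact: idl0.
Qed.

(** P is minimal over x, so a is nilpotent in the localisation of A/(x) at P. Otherwise an ideal
    containing x and maximal among those missing all a^k y, with y outside P, would be a prime
    strictly between 0 and P. *)
Lemma height_one_frac P x a : primeI P -> has_height P 1 -> P x -> x <> 0 -> P a ->
  exists y k b, ~ P y /\ a ^+ k * y = x * b.
Proof.
move=> [iP P1 pM] [_ hP] Px x0 Pa; apply: contrapT => H.
pose S I := [/\ idl I, I x & forall y k, ~ P y -> ~ I (a ^+ k * y)].
have ix : idl (addmul x setT [set 0]) by apply: idl_addmul => //; exact: idl_set0.
have [||Q [[iQ Qx Qd] Qmax]] := chain_stops_max (S := S) (x0 := addmul x setT [set 0])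
    (acc_stops (noetherian_acc A_noetherian)).
- by move=> ? [].
- split=> //; first by exists 1; rewrite //= mulr1 subrr.
  move=> y k nPy [b _ /eqP]; rewrite subr_eq0 => /eqP E; apply: H.
  by exists y, k, b.
have QP : Q `<=` P.
  by move=> z Qz; apply: contrapT => nPz; apply: (Qd z 0%N nPz); rewrite mul1r.
have nQa : ~ Q a by move=> Qa; apply: (Qd 1 1%N P1); rewrite mulr1.
have pQ : primeI Q.
  split=> //; first by move=> Q1; apply: nQa; rewrite -[a]mulr1; exact: idlM.
  move=> u v Quv; apply: contrapT => /not_orP[nQu nQv].
  have meet w : ~ Q w -> exists y k r, ~ P y /\ Q (a ^+ k * y - w * r).
    move=> nQw; apply: contrapT => Hw; apply: nQw.
    have iQw : idl (addmul w setT Q) by apply: idl_addmul.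
    apply: (Qmax (addmul w setT Q)).
    - split=> //; first exact: addmulr.
      by move=> y k nPy [r _ Qr]; apply: Hw; exists y, k, r.
    - by move=> z; exact: addmulr.
    - by rewrite -[X in addmul _ _ _ X]mulr1; exact: addmull.
  have [y [k [r [nPy Qy]]]] := meet u nQu; have [y' [k' [r' [nPy' Qy']]]] := meet v nQv.
  apply: (Qd (y * y') (k + k')%N) => [/pM[]//|].
  rewrite (_ : _ * _ = (a ^+ k' * y') * (a ^+ k * y - u * r) +
      (u * r) * (a ^+ k' * y' - v * r') + (r * r') * (u * v)); last by rewrite exprD; ring.
  by do !apply: idlD => //; exact: idlM.
suff : (2 <= 1)%N by [].
apply: (hP 2%N (fun i => if i is i'.+1 then (if i' is 0 then Q else P) else [set 0])); split.
  case=> [|[|i]] _ /=; split=> //.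
  - exact/is_primeP/primeI_set0.
  - by move=> z ->; exact: idl0.
  - exact/is_primeP.
  - exact/is_primeP.
case=> [|[|i]] //= _; split.
- by move=> z ->; exact: idl0.
- by move=> /(_ x Qx).
- by [].
- by move=> /(_ a Pa).
Qed.

(** [gdim_avoid] yields a leading form of an element of P; that element has the same class in G and
    can replace it. *)
Lemma gdim_avoid_ideal Z P D : gid Z -> primeI P -> (gdim Z <= D.+1)%N ->
  (gdim (ginit P) <= D)%N -> exists e f, [/\ (0 < e)%N, P f, pw e f & (gdim (gadd Z e f) <= D)%N].
Proof.
move=> gZ pP dZ dP; have [iP P1 _] := pP; have gP := gid_ginit m iP.
have [|e [f [e0 [fe [g Pg fg]] dA]]] := gdim_avoid A_noetherian A_local gZ gP _ dZ dP.
  move=> a [_ [p Pp ap]]; apply: (idl_sub _ ap) => //.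
  exact: (primeI_max A_noetherian A_local pP).
have ge : pw e g.
  by rewrite -(subKr f g); apply: idlB => //; exact: pw_le fg.
exists e, g; split=> //; apply: leq_trans dA.
have gA := gid_gadd gZ ge.
apply: gdim_le => //; first exact: gid_gadd.
apply: gadd_min => //; first exact: gle_gadd.
rewrite -(subrK g f); apply: idlD; first exact: (gid_idl _ gA).
  exact: (gid_pw gA).
exact: gadd_gen.
Qed.

Lemma height_one_adim P d s x : primeI P -> has_height P 1 -> P x ->
  pw s x -> ~ pw s.+1 x -> adim [set 0] = d.+1 -> (d <= adim P)%N.
Proof.
move=> pP hP Px xs nxs d0; rewrite leqNgt; apply/negP => dP.
have x0 : x <> 0 by move=> x0; apply: nxs; rewrite x0; exact: idl0.
have [iP P1 pM] := pP.
have dP1 := adim_gt0 A_noetherian A_local iP P1 (primeI_max A_noetherian A_local pP).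
have gZ := gid_gzero m.
have dz : gdim gzero = d.
  have := adim_ginit A_noetherian A_local idl_set0; rewrite d0 /= => <-.
  congr gdim; apply/funext => n; apply/seteqP; split=> z.
    by move=> zn; split; [exact: pw_le zn | exists 0; rewrite ?subr0].
  by move=> [_ [_ ->]]; rewrite subr0.
have dPi := adim_ginit A_noetherian A_local iP.
(* As [adim P] is positive and below d, there is room for two parameters. *)
case: d d0 dP dz => [|[|d]] d0 dP dz; [by []|by move: dP dP1; lia|].
have [||e1 [f1 [e1_gt0 Pf1 fe1 dA1]]] := @gdim_avoid_ideal gzero P d.+1 gZ pP.
- by rewrite dz.
- by rewrite dPi; lia.
have gA1 := gid_gadd gZ fe1.
have [|e2 [f2 [e2_gt0 Pf2 fe2 dA2]]] := @gdim_avoid_ideal _ P d gA1 pP dA1.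
  by rewrite dPi; lia.
have gA2 := gid_gadd gA1 fe2.
have [fs [hfs sfs dfs]] := gdim_parameters A_noetherian A_local gA2 dA2.
(* Both orders are needed: [gadds_cons_notin] shows the first form of a list to be nonzero in G. *)
have h12 : homog m ((e1, f1) :: (e2, f2) :: fs).
  by move=> p; rewrite !inE => /or3P[/eqP->|/eqP->|/hfs].
have h21 : homog m ((e2, f2) :: (e1, f1) :: fs).
  by move=> p; rewrite !inE => /or3P[/eqP->|/eqP->|/hfs].
have dL L : homog m L -> (e1, f1) \in L -> (e2, f2) \in L -> {subset fs <= L} ->
    gdim (gadds gzero L) = 0%N.
  move=> hL L1 L2 Lfs; have gL := gid_gadds gZ hL.
  apply/eqP; rewrite -leqn0 -dfs; apply: gdim_le => //; first exact: gid_gadds.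
  apply: gadds_min => //; last by move=> p /Lfs pL; exact: (gadds_mem gZ hL).
  apply: gadd_min => //; last exact: (gadds_mem gZ hL L2).
  by apply: gadd_min => //; [exact: gle_gadds | exact: (gadds_mem gZ hL L1)].
have sub12 p q : {subset fs <= [:: p, q & fs]} by move=> u ufs; rewrite !inE ufs !orbT.
have d12 : gdim (gadds gzero [:: (e1, f1), (e2, f2) & fs]) = 0%N.
  by apply: dL => //; rewrite !inE eqxx ?orbT.
have d21 : gdim (gadds gzero [:: (e2, f2), (e1, f1) & fs]) = 0%N.
  by apply: dL => //; rewrite !inE eqxx ?orbT.
have nfe1 : ~ pw e1.+1 f1.
  by apply: (gadds_cons_notin A_noetherian A_local gZ h12 _ d12); rewrite dz /= sfs.
have nfe2 : ~ pw e2.+1 f2.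
  by apply: (gadds_cons_notin A_noetherian A_local gZ h21 _ d21); rewrite dz /= sfs.
have [|W [t [c [sW RW Wfree [ct nct] cF]]]] :=
    multiplier_into_free A_noetherian A_local pw_domain h12 _ d12.
  by rewrite dz /= sfs.
have h2 : homog m ((e2, f2) :: fs) by have [_ _] := homog_cons h12.
have Wf2 n v : W n v -> W (n + e2)%N (f2 * v).
  move=> Wv; rewrite addnC; apply: RW Wv.
  exact: (galg_mem h2 (mem_head _ _)).
have [y1 [k1 [b1 [nPy1 E1]]]] := height_one_frac pP hP Px x0 Pf1.
have [y2 [k2 [b2 [nPy2 E2]]]] := height_one_frac pP hP Px x0 Pf2.
pose y := y1 * y2; have nPy : ~ P y by move=> /pM[].
(* x divides f1^k1 y1 and f2^k2 y2, so f1^(k1+k2) and f2^(k1+k2) both carry y/x into A. *)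
have Fy i : fracs f1 f2 x i (y ^+ i).
  exists ((k1 + k2) * i)%N, ((f1 ^+ k2 * y2 * b1) ^+ i), ((f2 ^+ k1 * y1 * b2) ^+ i).
  rewrite !exprM -!exprMn; split; congr (_ ^+ _).
    rewrite (_ : _ * y = (f1 ^+ k1 * y1) * (f1 ^+ k2 * y2)); last by rewrite /y exprD; ring.
    by rewrite E1; ring.
  rewrite (_ : _ * y = (f2 ^+ k2 * y2) * (f2 ^+ k1 * y1)); last by rewrite /y exprD; ring.
  by rewrite E2; ring.
have [i /(_ _ (Fy _))[b yb]] := fracs_integral A_noetherian A_local pw_domain sW Wfree Wf2
  e1_gt0 e2_gt0 fe1 nfe1 fe2 nfe2 ct nct xs nxs cF.
have : P (y ^+ i.+1) by rewrite yb mulrC; exact: idlM.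
elim: i.+1 => [|k IH]; first by [].
by rewrite exprS => /pM[].
Qed.

Lemma height_one_incomparable P Q : primeI P -> primeI Q -> has_height P 1 ->
  P <> [set 0] -> P <> Q -> has_height Q 1 -> ~ (P `<=` Q).
Proof.
move=> pP pQ hP P0 PQ [_ hQ] sPQ.
have [iP _ _] := pP; suff : (2 <= 1)%N by [].
apply: (hQ 2%N (fun i => if i is i'.+1 then (if i' is 0 then P else Q) else [set 0])); split.
  case=> [|[|i]] _ /=; split=> //.
  - exact/is_primeP/primeI_set0.
  - by have [iQ _ _] := pQ; move=> z ->; exact: idl0.
  - exact/is_primeP.
  - exact/is_primeP.
case=> [|[|i]] //= _; split=> //.
- by move=> z ->; exact: idl0.
- by move=> sP0; apply: P0; apply/seteqP; split=> // z ->; exact: idl0.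
- by move=> sQP; apply: PQ; apply/seteqP.
Qed.

(* With [y] in [Ps 0, ..., Ps r.-1] but not in [P = Ps r], multiplication by [y] embeds [A / P]
   in the kernel of the projection from the meet of [r + 1] primes to that of [r]. *)
Lemma Lf_prime_meet r (Ps : nat -> set A) : (forall i, (i < r)%N -> primeI (Ps i)) ->
  (forall i j, (i < r)%N -> (j < r)%N -> i <> j -> ~ (Ps i `<=` Ps j)) ->
  exists c : nat -> nat, forall n,
    (\sum_(i < r) Lf (Ps i) (n - c i) <= Lf [set a | forall i, (i < r)%N -> Ps i a] n)%N.
Proof.
elim: r => [|r IH] Psp Psn; first by exists (fun=> 0%N) => n; rewrite big_ord0.
have [||c cP] := IH.
- by move=> i ir; apply: Psp; exact: leqW.
- by move=> i j ir jr; apply: Psn; exact: leqW.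
have [iP P1 pM] := Psp r (leqnn _).
have [y yI nPy] : exists2 y, (forall i, (i < r)%N -> Ps i y) & ~ Ps r y.
  (* y is a product of elements of [Ps k] outside [Ps r], one for each k < r. *)
  have : forall k, (k <= r)%N -> exists2 y, (forall i, (i < k)%N -> Ps i y) & ~ Ps r y.
    elim=> [_|k IHk kr]; first by exists 1.
    have [y yk nPy] := IHk (ltnW kr).
    have : ~ (Ps k `<=` Ps r).
      by apply: Psn => //; [exact: leqW | move=> kE; move: kr; rewrite kE ltnn].
    move=> /existsNP[z /not_implyP[Pz nPz]]; exists (y * z); last by move=> /pM[].
    move=> i; rewrite ltnS leq_eqVlt => /predU1P[->|ik].
      by apply: idlM => //; have [] := Psp k (leqW kr).
    rewrite mulrC; apply: idlM; last exact: yk.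
    by have [] := Psp i (leqW (leq_trans ik (ltnW kr))).
  by move=> /(_ r (leqnn _)).
have [e eP] := colon_addpw m A_noetherian iP (fun a Pa => or_ind (fun h : Ps r y => False_ind _ (nPy h)) id (pM y a Pa)).
pose I k : set A := [set a | forall i, (i < k)%N -> Ps i a].
have iI k : (k <= r.+1)%N -> idl (I k).
  move=> kr; split=> [i ik|a u v Iu Iv i ik]; have [iPi _ _] := Psp i (leq_trans ik kr).
    exact: idl0.
  by apply: idlD => //; [apply: idlM => //; exact: Iu | exact: Iv].
exists (fun i => if i == r then e else c i) => n.
rewrite big_ord_recr /= eqxx.
under eq_bigr => i _ do rewrite ltn_eqF //.
have iy : idl (addmul y setT (I r.+1)) by apply: idl_addmul => //; exact: iI.
have [k L ->] := Len_colon A_noetherian A_local n y (iI _ (leqnn _)).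
rewrite addnC; apply: leq_add.
  apply: (Len_le (pw_unit A_noetherian A_local) (LfP A_noetherian A_local _ iP) L) => //.
  - exact: idl_addpw.
  - by apply: idl_colon; apply: idl_addpw; exact: iI.
  (* For n < e the truncated n - e is 0, and P + m^0 is all of A. *)
  - move=> z [p Ip yzp]; have [en|ne] := leqP e n; last first.
      by rewrite (eqP (ltnW ne : _ == _)); apply: addpwr => //; exact: pw0.
    apply: eP; rewrite subnK //; exists p => //; exact: Ip.
apply: leq_trans (cP n) _.
apply: (Lf_le A_noetherian A_local) => //; first exact: (iI r (leqnSn _)).
move=> z [b _ Izb] i ir; have [iPi _ _] := Psp i (leqW ir).
apply: (idl_sub iPi (Izb i (leqW ir))).
by rewrite mulrC; apply: idlM => //; exact: yI.
Qed.

Lemma height_one_count r (Ps : nat -> set A) d s x :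
  adim [set 0] = d.+1 -> pw s x -> ~ pw s.+1 x ->
  (forall i, (i < r)%N -> primeI (Ps i)) ->
  (forall i j, (i < r)%N -> (j < r)%N -> Ps i = Ps j -> i = j) ->
  (forall i, (i < r)%N -> has_height (Ps i) 1) -> (forall i, (i < r)%N -> Ps i x) ->
  r%:R <= s%:R * (d`!%:R * (apoly m [set 0])`_d).
Proof.
move=> d0 xs nxs Psp Psinj Psh Psx.
have q0P := apolyP A_noetherian A_local idl_set0.
set q0 := apoly m [set 0] in q0P *.
have q0d : 0 <= q0`_d by apply: eventually_ge0_coef (ev_poly_ge0 q0P) _; rewrite -d0.
case: r Psp Psinj Psh Psx => [|r] Psp Psinj Psh Psx; first by rewrite !mulr_ge0.
have x0 : x <> 0 by move=> x0; apply: nxs; rewrite x0; exact: idl0.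
have Psn0 i : (i < r.+1)%N -> Ps i <> [set 0].
  by move=> ir E; apply: x0; have := Psx i ir; rewrite E.
have [|c cP] := Lf_prime_meet Psp.
  move=> i j ir jr ij; apply: height_one_incomparable; try solve [exact: Psp|exact: Psh|exact: Psn0].
  by move=> /Psinj E; apply: ij; exact: E.
have iX : idl (addmul x setT [set 0]) by apply: idl_addmul => //; exact: idl_set0.
pose p (i : 'I_r.+1) := apoly m (Ps i) \Po ('X - (c i)%:R%:P).
have pP (i : 'I_r.+1) : ev_poly (fun n => Lf (Ps i) (n - c i)) (p i).
  by apply: ev_poly_shift; apply: apolyP => //; have [] := Psp i (ltn_ord i).
(* As m^n : x lies in m^(n-s), the submodule of A/m^n generated by x has length at least that of
   A/m^(n-s); the quotient by it maps onto A modulo m^n and the meet of the primes. *)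
have key n : (\sum_(i < r.+1) Lf (Ps i) (n - c i) + Lf [set 0%R] (n - s) <= Lf [set 0%R] n)%N.
  have [k L ->] := Len_colon A_noetherian A_local n x idl_set0.
  rewrite addnC; apply: leq_add.
    apply: (Len_le (pw_unit A_noetherian A_local) (LfP A_noetherian A_local _ idl_set0) L) => //.
    - exact: (idl_addpw m _ idl_set0).
    - exact: idl_colon (idl_addpw m _ idl_set0).
    - move=> z [_ -> ]; rewrite subr0 => xz; exists 0 => //; rewrite subr0.
      have := pw_div pw_domain (k := 1) xs nxs; rewrite muln1; apply.
      by rewrite expr1.
  apply: leq_trans (cP n) _; apply: (Lf_le A_noetherian A_local) => //.
    split=> [i ir|a u v Iu Iv i ir]; have [iPi _ _] := Psp i ir; first exact: idl0.
    by apply: idlD => //; [apply: idlM => //; exact: Iu | exact: Iv].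
  move=> z [b _ /eqP]; rewrite subr_eq0 => /eqP-> i ir; have [iPi _ _] := Psp i ir.
  by rewrite mulrC; apply: idlM => //; exact: Psx.
pose Q := back_diff s%:R q0.
have sumP : ev_poly (fun n => \sum_(i < r.+1) Lf (Ps i) (n - c i))%N (\sum_i p i).
  have : forall l : seq 'I_r.+1,
      ev_poly (fun n => \sum_(i <- l) Lf (Ps i) (n - c i))%N (\sum_(i <- l) p i).
    elim=> [|i l IHl]; first by exists 0%N => n _; rewrite !big_nil horner0.
    rewrite big_cons; apply: (ev_poly_eq (ev_polyD (pP i) IHl)).
    by exists 0%N => n _; rewrite big_cons.
  exact.
have [M MP] := ev_poly_back s q0P.
have QS : eventually_ge0 (Q - \sum_i p i).
  have [N NP] := sumP; exists (maxn M N) => n; rewrite geq_max => /andP[/MP E1 /NP E2].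
  rewrite hornerD hornerN -E1 -E2; have := key n.
  by rewrite -(ler_nat rat) natrD; lra.
have Qp (i : 'I_r.+1) : eventually_ge0 (Q - p i).
  have [N NP] := pP i; exists (maxn M N) => n; rewrite geq_max => /andP[/MP E1 /NP E2].
  rewrite hornerD hornerN -E1 -E2; have := key n; rewrite (bigD1 i) //=.
  by rewrite -(ler_nat rat) !natrD; have := ler0n rat (\sum_(j < r.+1 | j != i) Lf (Ps j) (n - c j)); lra.
have d1 : (0 < d)%N.
  have [iP P1 pM] := Psp 0%N isT.
  have a1 := adim_gt0 A_noetherian A_local iP P1 (primeI_max A_noetherian A_local (Psp 0%N isT)).
  have : [set 0] `<` Ps 0%N.
    split; first by move=> z ->; exact: idl0.
    by move=> /(_ x (Psx 0%N isT)).
  move=> /(adim_prime_lt A_noetherian A_local primeI_set0 iP); rewrite d0 /=; exact: leq_trans.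
case: d d1 d0 q0d => // d _ d0 q0d.
have sq0 : (size q0 <= d.+2)%N by rewrite -d0.
have [sQ cQ] := @back_diff_coef s%:R q0 d.+1 sq0.
(* Each p i is eventually at most Q, of size at most d + 1; [height_one_adim] gives the converse. *)
have sp (i : 'I_r.+1) : size (p i) = d.+1.
  have [iPi _ _] := Psp i (ltn_ord i).
  apply/eqP; rewrite eqn_leq; apply/andP; split.
    exact: leq_trans (eventually_ge0_size (ev_poly_ge0 (pP i)) (Qp i)) sQ.
  rewrite size_comp_shift.
  exact: (height_one_adim (Psp i (ltn_ord i)) (Psh i (ltn_ord i)) (Psx i (ltn_ord i)) xs nxs d0).
have cp (i : 'I_r.+1) : 1 <= d`!%:R * (p i)`_d.
  have : d`!%:R * (p i)`_d \is a Num.int.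
    have [N NP] := pP i.
    by apply: (@int_valued_coef _ d N); [rewrite sp | move=> n /NP <-; exact: natr_int].
  have pos : 0 < d`!%:R * (p i)`_d.
    rewrite mulr_gt0 ?ltr0n ?fact_gt0 // lt0r (eventually_ge0_coef (ev_poly_ge0 (pP i))) ?sp //.
    by rewrite -[d]/(d.+1.-1) -(sp i) -lead_coefE lead_coef_eq0 -size_poly_eq0 sp.
  by move=> /intrP[z zE]; move: pos; rewrite zE -[1]/(1%:~R) ltr0z ler_int gtz0_ge1.
have sS : (size (Q - \sum_i p i)%R <= d.+1)%N.
  rewrite (leq_trans (size_polyD _ _)) // size_polyN geq_max sQ /=.
  by apply: (leq_trans (size_sum _ _ _)); apply/bigmax_leqP => i _; rewrite sp.
have := eventually_ge0_coef QS sS; rewrite coefB coef_sum subr_ge0 cQ => H.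
have -> : s%:R * ((d.+1)`!%:R * q0`_d.+1) = d`!%:R * (s%:R * d.+1%:R * q0`_d.+1).
  by rewrite factS natrM; ring.
apply: le_trans (ler_wpM2l (ler0n _ _) H).
rewrite mulr_sumr -[r.+1 in X in X <= _]card_ord -sum1_card natr_sum.
by apply: ler_sum => i _; exact: cp.
Qed.

End HeightOne.
(** * Comparison with the Hilbert-Samuel polynomial of [A] *)

Section SubmodulesOfQuotient.
Variables (A : comNzRingType) (I : submodClosed (A^o : lmodType A)).
Local Notation M := (@quot_module A A^o I).
Local Notation "\pi a" := (\pi_M (a : A^o) : M)%qT (at level 10).

Lemma idl_preim_submodule (N : set M) : is_submodule N -> idl [set a : A | N (\pi a)].
Proof.
move=> [N0 NP]; split; rewrite /=.
  have -> : \pi 0 = 0 by exact/pi_quot_eq0/rpred0.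
  by rewrite inE in N0.
move=> a u v Nu Nv; have := NP a (\pi u) (\pi v); rewrite !inE => /(_ Nu Nv).
by rewrite scale_pi_quot -pi_quotD.
Qed.

Lemma submodule_image_idl (J : set A) : idl J ->
  is_submodule [set v : M | exists2 a, J a & v = \pi a].
Proof.
move=> iJ; split.
  by rewrite inE; exists 0; [exact: idl0 | apply/esym/pi_quot_eq0/rpred0].
move=> a u v; rewrite !inE => -[b Jb ->] [c Jc ->]; exists (a * b + c).
  by case: iJ => _; apply.
by rewrite scale_pi_quot -pi_quotD.
Qed.

Lemma Len_has_length (K : set A) l : idl K ->
  (forall a, ~ K a -> exists b, b * a = 1) ->
  Len K [set a : A | (a : A^o) \in I] setT l -> has_length M l.
Proof.
move=> iK Kunit L; have iI : idl [set a : A | (a : A^o) \in I].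
  split=> [|a u v Iu Iv] /=; first exact: (@rpred0 A^o I).
  by apply: (@rpredD A^o I) => //; exact: (@rpredZ A A^o I).
split.
  have [c [c0 cl ic cS]] := Len_has_chain L iI.
  exists (fun i => [set v : M | exists2 a, c i a & v = \pi a]); split.
    by move=> i _; exact: submodule_image_idl.
  move=> i il; have [cc ncc] := cS i il; split.
    by move=> v [a /cc ca ->]; exists a.
  have Ic : forall k, (k <= l)%N -> [set a : A | (a : A^o) \in I] `<=` c k.
    elim=> [|k IHk] kl; first by rewrite c0.
    by apply: subset_trans (IHk (ltnW kl)) _; have [] := cS k kl.
  move=> sub; apply: ncc => a ca.
  have [|b cb ab] := sub (\pi a); first by exists a.
  apply: (idl_sub (ic i) (v := b)) => //; apply: (Ic i (ltnW il)) => /=.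
  apply/pi_quot_eq0; rewrite pi_quotD ab -pi_quotD subrr; exact/pi_quot_eq0/rpred0.
move=> k c [cN cS].
apply: (Len_chain Kunit L iI (c := fun i => [set a : A | c i (\pi a)])) => //.
- by move=> i ik; apply: idl_preim_submodule; exact: cN.
- move=> i ik; have [cc ncc] := cS i ik; split; first by move=> a; exact: cc.
  by move=> sub; apply: ncc => v; elim/quot_moduleW: v => a; exact: sub.
- move=> a /= /pi_quot_eq0 ->; have [c0 _] := cN 0%N (leq0n _).
  by rewrite inE in c0.
Qed.

End SubmodulesOfQuotient.

Lemma max_chain_length_uniq (T : Type) (F : set (set T)) a b :
  max_chain_length F a -> max_chain_length F b -> a = b.
Proof.
move=> [[c cF] amax] [[c' c'F] bmax]; apply/eqP.
by rewrite eqn_leq (bmax _ _ cF) (amax _ _ c'F).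
Qed.

(** The Hilbert-Samuel polynomial measures A/m^(n+1) and [Lf] measures A/m^n; this shift by one
    leaves the coefficient of degree d unchanged. *)
Lemma multiplicity_apoly (A : comNzRingType) (m : idealr A) d :
  noetherian A -> is_local m -> adim m [set 0] = d.+1 ->
  multiplicity m d = d`!%:R * (apoly m [set 0])`_d.
Proof.
move=> noeth loc d0; have i0 := @idl_set0 A.
set q := apoly m [set 0].
pose H := q \Po ('X - (-1)%:P).
have lenP n : has_length (quot_module (ideal_pow m n.+1)) (Lf m [set 0] n.+1).
  apply: (Len_has_length (K := pw m 1) (idl_pw m 1) (pw_unit noeth loc)).
  have := LfP noeth loc n.+1 i0; congr Len; apply/seteqP; split=> a.
    by move=> [_ ->]; rewrite subr0.
  by exists 0; rewrite ?subr0.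
have HH : is_hilbert_samuel_poly m H.
  have [N NP] := apolyP noeth loc i0; exists N => n Nn.
  exists (Lf m [set 0] n.+1) => //.
  by rewrite NP ?leqW // horner_comp !hornerE natr1.
rewrite /multiplicity /hilbert_samuel_poly; case: xgetP => [H' _ HH'|/(_ H)//].
have -> : H' = H.
  have [N NP] := HH; have [N' N'P] := HH'.
  apply: (@eventually_eq_poly _ _ (maxn N N')) => n; rewrite geq_max => /andP[Nn N'n].
  have [l Ll ->] := NP n Nn; have [l' Ll' ->] := N'P n N'n.
  by rewrite (max_chain_length_uniq Ll Ll').
congr (_ * _); have -> : H = q - back_diff (-1) q by rewrite /back_diff opprB addrC subrK.
have [sd _] := @back_diff_coef (-1) q d (eq_leq d0).
by rewrite coefB [(back_diff _ _)`_d]nth_default ?subr0.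
Qed.

Lemma card_le_inj (T : pointedType) (B : set nat) (S : set T) : (B #<= S)%card ->
  exists f : nat -> T, (forall i, B i -> S (f i)) /\
    forall i j, B i -> B j -> f i = f j -> i = j.
Proof.
move=> /pcard_leP/injfunPex[f fS finj]; exists f; split=> // i j Bi Bj.
by apply: finj; exact: mem_set.
Qed.

Theorem lemma2p1 (A : comNzRingType) (m : idealr A) (d s : nat) (x : A)
    (A_noetherian : noetherian A) (A_local : is_local m)
    (A_dim : has_krull_dim A d)
    (gr_domain : GRing.integral_domain_axiom (assoc_graded m))
    (x_in : x \in ideal_pow m s) (x_notin : x \notin ideal_pow m s.+1) :
  exists n : nat,
    (Ass_height 1 (quot_module (ideal_gen [set x])) #= `I_n)%card /\
    n%:R <= s%:R * multiplicity m d.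
Proof.
have dom := assoc_graded_pw_domain gr_domain.
have d0 := adim_krull_dim A_noetherian A_local (primeI_set0 A_noetherian A_local dom) A_dim.
rewrite (multiplicity_apoly A_noetherian A_local d0).
set S := Ass_height _ _; set e := _ * _.
(* P annihilates a class of A/(x), and x kills that whole module. *)
have Sx P : S P -> P x.
  move=> [[_ [v ->]] _] /=; elim/quot_moduleW: v => b.
  rewrite scale_pi_quot; apply/pi_quot_eq0.
  rewrite /GRing.scale /= mulrC; apply: (@rpredZ A A^o (ideal_gen [set x])).
  exact: ideal_gen_mem.
have bound r (f : nat -> set A) : (forall i, (i < r)%N -> S (f i)) ->
    (forall i j, (i < r)%N -> (j < r)%N -> f i = f j -> i = j) -> r%:R <= e.
  move=> fS finj; apply: (height_one_count A_noetherian A_local dom d0 x_in) finj _ _.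
  - exact/negP.
  - by move=> i /fS[[/is_primeP]].
  - by move=> i /fS[].
  - by move=> i /fS /Sx.
have [n nS] : finite_set S.
  (* An infinite S would contain [Num.bound e] distinct primes, which is more than e. *)
  apply/finite_setPn => /card_le_inj[f [fS finj]].
  have := bound (Num.bound e) f (fun i _ => fS i Logic.I) (fun i j _ _ => finj i j Logic.I Logic.I).
  rewrite leNgt archi_boundP //.
  exact: (bound 0%N f).
exists n; split=> //.
have /card_le_inj[f [fS finj]] : (`I_n #<= S)%card.
  by move: nS; rewrite card_eq_sym card_eq_le => /andP[].
exact: bound finj.
Qed.
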